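(* Let $d \ge 1$ and $\varepsilon > 0$. (a) $\mathbb{P}\big(|R_n - \mathbb{E} R_n| \ge (\ln n)^{3d/4 + \varepsilon} \text{ infinitely often}\big) = 0$; consequently $R_n / \mathbb{E} R_n \to 1$ almost surely. (b) $\mathbb{P}\big(|\beta_n - \mathbb{E} \beta_n| \ge (\ln n)^{3d/4 + \varepsilon} \text{ infinitely often}\big) = 0$; consequently $\beta_n / \mathbb{E} \beta_n \to 1$ almost surely. (c) $\mathbb{P}\big(|r_n - \mathbb{E} r_n| \ge (\ln n)^{3d/4 + \varepsilon} \text{ infinitely often}\big) = 0$; consequently, if $d \ge 5$, then $r_n / \mathbb{E} r_n \to 1$ almost surely.
   Context: Fix an integer $d \ge 1$. Let $X^{(1)}, X^{(2)}, \dots$ be i.i.d. random vectors in $\mathbb{R}^d$ with independent Exponential$(1)$ coordinates. Write $x \prec y$ if $x_j<y_j$ for all $j$. $X^{(k)}$ is a (Pareto) record if $X^{(k)} \not\prec X^{(i)}$ for all $1 \le i < k$; for $1 \le k \le n$, $X^{(k)}$ is a current record at time $n$ if $X^{(k)} \not\prec X^{(i)}$ for all $1 \le i \le n$. $R_n$ is the number of records among $X^{(1)},\dots,X^{(n)}$, $r_n$ is the number of current records at time $n$, and $\beta_n := R_n - r_n$ is the number of broken records at time $n$. *)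

(* Defs.v *)
From HB Require Import structures.
From mathcomp Require Import all_boot all_order all_algebra.
From mathcomp Require Import all_classical all_reals all_analysis.
Set Implicit Arguments. Unset Strict Implicit. Unset Printing Implicit Defensive.
Import Order.TTheory GRing.Theory Num.Theory.
Import numFieldNormedType.Exports.
Local Open Scope classical_set_scope.
Local Open Scope ring_scope.

Section defs.
Context {R : realType} {dT : measure_display} {T : measurableType dT}.

Definition mutually_independent {I : eqType} (P : probability T R)
    (Y : I -> T -> R) : Prop :=
  forall (J : seq I) (B : I -> set R), uniq J ->
    (forall i, measurable (B i)) ->
    P (\bigcap_(i in [set` J]) (Y i @^-1` B i)) =
    (\prod_(i <- J) P (Y i @^-1` B i))%E.

Definition exp1_distributed (P : probability T R) (Y : T -> R) : Prop :=
  forall V : set R, measurable V -> P (Y @^-1` V) = exponential_prob (1:R) V.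

Definition prec (d : nat) (x y : 'I_d -> R) : bool := [forall j, x j < y j].

(** Random vectors X k : 'I_d -> R, k = 0,1,2,... (X k is X^(k+1) of the paper).
    record: X^(k) not dominated by any earlier vector. *)
Definition is_record (d : nat) (X : nat -> 'I_d -> T -> R) (w : T) (k : nat) : bool :=
  [forall i : 'I_k, ~~ prec (fun j => X k j w) (fun j => X i j w)].

Definition is_current_record (d : nat) (X : nat -> 'I_d -> T -> R) (n : nat)
    (w : T) (k : nat) : bool :=
  [forall i : 'I_n, ~~ prec (fun j => X k j w) (fun j => X i j w)].

Definition Rrec (d : nat) (X : nat -> 'I_d -> T -> R) (n : nat) (w : T) : nat :=
  count (is_record X w) (iota 0 n).
Definition rcur (d : nat) (X : nat -> 'I_d -> T -> R) (n : nat) (w : T) : nat :=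
  count (is_current_record X n w) (iota 0 n).
Definition beta (d : nat) (X : nat -> 'I_d -> T -> R) (n : nat) (w : T) : nat :=
  (Rrec X n w - rcur X n w)%N.

(** E[Z_n] as a real number (Z_n is bounded by n, so this is finite). *)
Definition Enat (P : probability T R) (Z : nat -> T -> nat) (n : nat) : R :=
  fine ('E_P[fun w => (Z n w)%:R])%E.

Definition dev_io (P : probability T R) (Z : nat -> T -> nat) (a : R) : set T :=
  [set w | forall N : nat, exists2 n : nat, (N <= n)%N &
     powR (ln n%:R) a <= `|(Z n w)%:R - Enat P Z n|].

Definition ratio_to_one (P : probability T R) (Z : nat -> T -> nat) : Prop :=
  {ae P, forall w, ((Z n w)%:R / Enat P Z n) @[n --> \oo] --> (1:R)}.

End defs.

(* Main.v *)
Require Import Defs.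
From HB Require Import structures.
From mathcomp Require Import all_boot all_order all_algebra.
From mathcomp Require Import all_classical all_reals all_analysis.
From mathcomp Require Import measurable_realfun.
From mathcomp Require Import zify ring lra.
Set Implicit Arguments. Unset Strict Implicit. Unset Printing Implicit Defensive.
Import Order.TTheory GRing.Theory Num.Theory.
Import numFieldNormedType.Exports.
Local Open Scope classical_set_scope.
Local Open Scope ring_scope.

(** Write [p j] for the probability that a vector is not dominated by [j] others, so
    that [E R_n] is the sum of the [p j], [j < n], and [E r_n = n p_(n-1)].

    Given two vectors with upper orthants of mass [a] and [b] meeting in mass [c],
    the positive part of the covariance of their record indicators is at most
    [j c (1 - max(a, b))^(j-1) (1 - b)^(k-j-1)].  Summed over [j < k < n] this is
    [(c / b) G^2] with [G <= min (n, 1 / max(a, b))].  Interpolating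
    [min (n, 1 / x) <= 2 / x^(1 - 1/L)] with [n <= 2^L], and [max(a, b)] by a
    geometric mean of [a] and [b], makes the expectation of this bound factorise
    over the [d] coordinates, each factor being of order [L].  Hence [Var R_n] and
    [Var r_n], and so [Var beta_n], are [O((ln n)^d)].  Expectations over continuous
    vectors are replaced by sums over grid cells, at the cost of an event (two
    vectors sharing a cell) of arbitrarily small probability.

    Conversely [E R_n] and [E beta_n] are at least of order [(ln n)^d].  Since
    [R_n] and [beta_n] are monotone in [n], Chebyshev's inequality at the ends of
    the blocks [k^4 <= E Z_n < (k+1)^4] and the Borel-Cantelli lemma give
    [|Z_n - E Z_n| = O((E Z_n)^(3/4))] almost surely; [r_n = R_n - beta_n]. *)

(** * Geometric sums *)

Section geometric.
Context {R : realFieldType}.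
Implicit Types (x t q : R) (n m k : nat).

(** Blocks [k ^ g <= E Z_n < (k + 1) ^ g] have length of order [k ^ (g - 1)], and Chebyshev at that
    deviation costs [k ^ g / k ^ (2 g - 2)], summable only for [g > 3]. The integer choice [g = 4]
    yields the exponent 3/4, and the margin [eps] absorbs the constant. The sequence [r_n] is not
    monotone, so it cannot be treated this way directly; its mean is only bounded below by order
    [(ln n) ^ (d - 1)], whence the condition [3 d < 4 (d - 1)] for its ratio. The obstacle in the
    variance is the maximum of the two masses, which does not factorise over the coordinates. A
    geometric mean does, but its weights matter: the factor [c / b] is asymmetric in the two
    vectors, and equal weights would leave no decay on one side of the diagonal. The weights 3/4 and
    1/4 restore it. All estimates on the grid are uniform in its mesh, which is chosen after [n], so
    that the discretisation errors of all pairs together stay below 1. *)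

Definition geo n x : R := \sum_(j < n) (1 - x) ^+ j.

Lemma geo_ge0 n x : 0 <= x <= 1 -> 0 <= geo n x.
Proof. by move=> ?; apply: sumr_ge0 => j _; apply: exprn_ge0; lra. Qed.

Lemma geoE n x : x * geo n x = 1 - (1 - x) ^+ n.
Proof.
rewrite /geo; elim: n => [|n IH]; first by rewrite big_ord0 mulr0 expr0 subrr.
by rewrite big_ord_recr /= mulrDr IH exprS; ring.
Qed.

Lemma geo_mul_le1 n x : 0 <= x <= 1 -> x * geo n x <= 1.
Proof. by move=> hx; rewrite geoE gerBl exprn_ge0//; lra. Qed.

Lemma geo_le_nat n x : 0 <= x <= 1 -> geo n x <= n%:R.
Proof.
move=> hx; rewrite -[n in n%:R]card_ord -sumr_const; apply: ler_sum => j _.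
by apply: exprn_ile1; lra.
Qed.

(** The terms decrease, so each of the first [h] is at least [(1 - x) ^ h]. This converts a bare
    power, as it occurs for current records, into [geo], and both variances end in the same grid
    sums. *)
Lemma geo_ge_mulX n x h : (h <= n)%N -> 0 <= x <= 1 ->
  h%:R * (1 - x) ^+ h <= geo n x.
Proof.
move=> hn hx; rewrite /geo -(big_mkord xpredT (fun j => (1 - x) ^+ j)).
rewrite (big_cat_nat _ hn)//= -[X in X <= _]addr0 lerD//; last first.
  by apply: sumr_ge0 => j _; apply: exprn_ge0; lra.
rewrite big_mkord mulr_natl -[h in _ *+ h]card_ord -sumr_const.
by apply: ler_sum => j _; apply: ler_wiXn2l; [lra|lra|exact/ltnW].
Qed.

Lemma sum_geometric_le1 K x : 0 <= x <= 1 -> (1 - x) * \sum_(m < K) x ^+ m <= 1.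
Proof.
move=> hx; rewrite -[X in _ * X](_ : geo K (1 - x) = _).
  by apply: geo_mul_le1; lra.
by apply: eq_bigr => m _; congr (_ ^+ _); ring.
Qed.

Lemma sum_geometric_dist_le2 K m0 x : 0 <= x <= 1 -> (m0 <= K)%N ->
  (1 - x) * \sum_(m < K) x ^+ ((m - m0) + (m0 - m)) <= 2.
Proof.
move=> hx hm; rewrite -(big_mkord xpredT (fun m => x ^+ ((m - m0) + (m0 - m)))).
rewrite (big_cat_nat _ hm)//= mulrDr; have -> : 2 = 1 + 1 :> R by [].
apply: lerD.
  rewrite big_nat_rev /= add0n big_mkord.
  apply: le_trans (sum_geometric_le1 m0 hx); apply: ler_wpM2l; first lra.
  apply: ler_sum => i _; apply: ler_wiXn2l; [lra|lra|].
  by have := ltn_ord i; lia.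
rewrite -{1}[m0]add0n big_addn big_mkord.
apply: le_trans (sum_geometric_le1 (K - m0) hx); apply: ler_wpM2l; first lra.
by apply: ler_sum => i _; apply: ler_wiXn2l; [lra|lra|lia].
Qed.

(** Bernoulli's inequality, used to compare the grid step [1 - q] with the step [1 - t ^ s] of a
    more slowly decaying geometric series. *)
Lemma subr1X_le k s t : 0 <= t <= 1 -> 1 - t ^+ (s * k) <= k%:R * (1 - t ^+ s).
Proof.
move=> ht; rewrite exprM; have : 0 <= t ^+ s <= 1.
  by rewrite exprn_ge0 ?exprn_ile1//; lra.
elim: k => [|k IH] hs; first by rewrite expr0 mul0r subrr.
have {}IH := IH hs.
have hk : 0 <= (t ^+ s) ^+ k <= 1 by rewrite exprn_ge0 ?exprn_ile1//; lra.
by rewrite exprS -natr1; nra.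
Qed.

(* Interpolates between the bounds [n <= 2 ^ L] and [1 / y ^ L]; the lost factor
   [1 / y] is what turns a divergent sum over scales into one of size [L]. *)
Lemma geo_le_interp n L y : (0 < L)%N -> (n <= 2 ^ L)%N -> 0 < y <= 1 ->
  geo n (y ^+ L) <= 2 / y ^+ L.-1.
Proof.
move=> L0 hn hy; have hy1 : 0 < y ^+ L.-1 by apply: exprn_gt0; lra.
have hyL : 0 <= y ^+ L <= 1 by rewrite exprn_ge0 ?exprn_ile1//; lra.
rewrite ler_pdivlMr//; have [y2|y2] := leP (2^-1) y.
  have : y ^+ L * geo n (y ^+ L) <= 1 by exact: geo_mul_le1.
  rewrite -{1}(prednK L0) exprS -mulrA => h; rewrite mulrC.
  have : 2^-1 * (y ^+ L.-1 * geo n (y ^+ L)) <= y * (y ^+ L.-1 * geo n (y ^+ L)).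
    by apply: ler_wpM2r => //; apply: mulr_ge0; [exact: ltW|exact: geo_ge0].
  by lra.
have : geo n (y ^+ L) * y ^+ L.-1 <= (2 ^ L)%:R * (2^-1) ^+ L.-1.
  apply: ler_pM; [exact: geo_ge0|exact: ltW| |].
    by apply: le_trans (geo_le_nat n hyL) _; rewrite ler_nat.
  by apply: lerXn2r; rewrite ?nnegrE; lra.
move/le_trans; apply; rewrite -{1}(prednK L0) expnS natrM natrX -mulrA -exprMn.
by rewrite divff ?expr1n ?mulr1// pnatr_eq0.
Qed.

End geometric.

(** * Covariance of two record indicators, given their orthants *)

Section covariance_pointwise.
Context {R : realFieldType}.
Implicit Types (a b c x y z : R) (n j k : nat).

(** A one-sided mean value inequality: [z] dominates the intermediate points and [c] the increment.
    The factor [j%:R] vanishes where [j.-1] is truncated. *)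
Lemma subrXX_le j x y z c : 0 <= x <= z -> 0 <= y <= z -> 0 <= c -> x <= y + c ->
  x ^+ j - y ^+ j <= j%:R * (c * z ^+ j.-1).
Proof.
move=> hx hy hc hxy; elim: j => [|j IH]; first by rewrite mul0r !expr0 subrr.
have hxj : 0 <= x ^+ j <= z ^+ j.
  by rewrite exprn_ge0 ?lerXn2r ?nnegrE//; lra.
have hz : z ^+ j.+1.-1 * c >= z * (j%:R * (c * z ^+ j.-1)) - j%:R * (c * z ^+ j) + c * z ^+ j.
  case: j {IH hxj} => [|j] /=; first by rewrite !mul0r mulr0 expr0; lra.
  by rewrite exprS; lra.
have hN : 0 <= j%:R * (c * z ^+ j.-1).
  by rewrite mulr_ge0// mulr_ge0// exprn_ge0//; lra.
rewrite !exprS -natr1 /= in hz *.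
have h1 : x * x ^+ j - y * x ^+ j <= c * z ^+ j by nra.
have h2 : y * x ^+ j - y * y ^+ j <= z * (j%:R * (c * z ^+ j.-1)) by nra.
lra.
Qed.

Lemma geoS n x : geo n.+1 x = 1 + (1 - x) * geo n x.
Proof.
rewrite /geo big_ord_recl expr0 mulr_sumr; congr (_ + _).
by apply: eq_bigr => j _; rewrite -exprS.
Qed.

Lemma geo_leS n x : 0 <= x <= 1 -> geo n x <= geo n.+1 x.
Proof. by move=> hx; rewrite /geo big_ord_recr lerDl exprn_ge0//; lra. Qed.

(** In the double sum [geo n x ^ 2] the power [(1 - x) ^ j.-1] with [0 < j < n] occurs [j] times,
    once for each pair of exponents with that sum. *)
Lemma sum_ord_mulX_le n x : 0 <= x <= 1 ->
  \sum_(j < n) j%:R * (1 - x) ^+ j.-1 <= geo n x ^+ 2.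
Proof.
move=> hx.
have rec m : \sum_(j < m.+1) j%:R * (1 - x) ^+ j.-1 =
    (1 - x) * (\sum_(j < m) j%:R * (1 - x) ^+ j.-1) + geo m x.
  rewrite big_ord_recl mul0r add0r mulr_sumr -big_split /=.
  apply: eq_bigr => -[[|j] hj] _ /=; rewrite ?mul0r ?mulr0 ?expr0 /bump /=.
    by rewrite add0r mulr1.
  by rewrite [in RHS]exprS add1n -[j.+2%:R]natr1 exprS; ring.
elim: n => [|n IH]; first by rewrite big_ord0 sqr_ge0.
rewrite rec expr2.
have h1 := geo_leS n hx; have h0 := geo_ge0 n hx.
apply: le_trans (_ : geo n.+1 x * geo n x <= _); last first.
  by apply: ler_wpM2l => //; exact: le_trans h1.
by rewrite geoS; nra.
Qed.

Lemma mulr_subr1_le a b : 0 <= a <= 1 -> 0 <= b <= 1 ->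
  0 <= (1 - a) * (1 - b) <= 1 - Num.max a b.
Proof.
move=> /andP[a0 a1] /andP[b0 b1]; rewrite mulr_ge0 ?subr_ge0 //= lerBrDr.
by case: (leP a b) => hab; nra.
Qed.

Lemma inclusion_exclusion_le a b c : 0 <= a <= 1 -> 0 <= b <= 1 ->
  a * b <= c -> c <= a -> c <= b -> 0 <= 1 - a - b + c <= 1 - Num.max a b.
Proof.
move=> ha hb hab hca hcb; have := mulr_subr1_le ha hb.
by case: (leP a b) => _; lra.
Qed.

(** The two bases differ by [c - a * b <= c], and both are at most [1 - Num.max a b]. *)
Lemma subrXX_cov_le j a b c : 0 <= a <= 1 -> 0 <= b <= 1 ->
  a * b <= c -> c <= a -> c <= b ->
  (1 - a - b + c) ^+ j - ((1 - a) * (1 - b)) ^+ j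
  <= j%:R * (c * (1 - Num.max a b) ^+ j.-1).
Proof.
move=> ha hb hab hca hcb; apply: subrXX_le.
- exact: inclusion_exclusion_le.
- exact: mulr_subr1_le.
- nra.
- nra.
Qed.

Lemma maxr_itv01 a b : 0 < a <= 1 -> 0 < b <= 1 -> 0 <= Num.max a b <= 1.
Proof. by move=> ha hb; case: (leP a b); lra. Qed.

Lemma sum_geometric_tail_le1 b j n : 0 <= b <= 1 -> (j <= n)%N ->
  \sum_(j.+1 <= k < n.+1) b * (1 - b) ^+ (k - j).-1 <= 1.
Proof.
move=> hb hj; rewrite -mulr_sumr -{1}[j.+1]add0n big_addn subSS big_mkord.
rewrite (eq_bigr (fun k : 'I_(n - j) => (1 - b) ^+ k)).
  exact: (geo_mul_le1 (n - j)).
by move=> k _; congr (_ ^+ _); lia.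
Qed.

(* [(1 - a - b + c) ^ j] is the probability that [j] vectors avoid both orthants
   and [c / b] is what remains after summing the geometric series in [k]. *)
Lemma record_cov_le n a b c : 0 < a <= 1 -> 0 < b <= 1 -> a * b <= c -> c <= a ->
    c <= b ->
  \sum_(k < n) \sum_(j < k)
    ((1 - a - b + c) ^+ j * (1 - b) ^+ (k - j).-1 - (1 - a) ^+ j * (1 - b) ^+ k)
  <= c / b * geo n (Num.max a b) ^+ 2 + geo n a.
Proof.
move=> ha hb hab hca hcb; have hmu := maxr_itv01 ha hb.
set mu := Num.max a b in hmu *.
have hc : 0 <= c by nra.
have [ha' hb'] : 0 <= a <= 1 /\ 0 <= b <= 1 by split; lra.
case: n => [|n]; first by rewrite /geo !big_ord0 expr2 mulr0 mulr0 addr0.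
(* The second term of [F] pays for vector [j] itself: the product of the marginals contains a factor
   [1 - b] for it, which the joint bound lacks. *)
pose F (j k : nat) : R :=
  c / b * (j%:R * (1 - mu) ^+ j.-1) * (b * (1 - b) ^+ (k - j).-1)
  + (1 - a) ^+ j * (b * (1 - b) ^+ (k - j).-1).
apply: (@le_trans _ _ (\sum_(k < n.+1) \sum_(j < k) F j k)).
  apply: ler_sum => k _; apply: ler_sum => -[j /= hj] _.
  have h1 := subrXX_cov_le j ha' hb' hab hca hcb.
  have hk : (k : nat) = ((j + (k - j).-1).+1)%N by clear -hj; lia.
  have e : (1 - a) ^+ j * (1 - b) ^+ k =
      ((1 - a) * (1 - b)) ^+ j * (1 - b) ^+ (k - j).-1
      - (1 - a) ^+ j * (1 - b) ^+ j * (b * (1 - b) ^+ (k - j).-1).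
    by rewrite {1}hk exprS exprD exprMn; ring.
  have hB : 0 <= (1 - b) ^+ (k - j).-1 by apply: exprn_ge0; lra.
  have hBj : 0 <= (1 - b) ^+ j <= 1 by rewrite exprn_ge0 ?exprn_ile1//; lra.
  have hA : 0 <= (1 - a) ^+ j by apply: exprn_ge0; lra.
  rewrite e /F; set Q := (1 - b) ^+ (k - j).-1 in hB *.
  have -> : c / b * (j%:R * (1 - mu) ^+ j.-1) * (b * Q) = j%:R * (c * (1 - mu) ^+ j.-1) * Q.
    by field; lra.
  have h2 : ((1 - a - b + c) ^+ j - ((1 - a) * (1 - b)) ^+ j) * Q
      <= j%:R * (c * (1 - mu) ^+ j.-1) * Q.
    exact: ler_wpM2r.
  have h3 : (1 - a) ^+ j * (1 - b) ^+ j * (b * Q) <= (1 - a) ^+ j * (b * Q).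
    apply: ler_wpM2r; first by rewrite mulr_ge0//; lra.
    by rewrite ler_piMr//; lra.
  lra.
have F0 j k : 0 <= F j k.
  rewrite /F addr_ge0// !mulr_ge0 ?invr_ge0 ?ler0n ?exprn_ge0//; lra.
rewrite (eq_bigr (fun k : 'I_n.+1 => \sum_(j < n.+1 | (j < k)%N) F j k)); last first.
  by move=> k _; rewrite (big_ord_widen n.+1 (fun j => F j k))// ltnW.
rewrite (exchange_big_dep xpredT)//=.
have -> : c / b * geo n.+1 mu ^+ 2 + geo n.+1 a =
    c / b * geo n.+1 mu ^+ 2 + \sum_(j < n.+1) (1 - a) ^+ j by [].
apply: (@le_trans _ _ (\sum_(j < n.+1)
   (c / b * (j%:R * (1 - mu) ^+ j.-1) + (1 - a) ^+ j))).
  apply: ler_sum => j _.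
  have -> : \sum_(k < n.+1 | (j < k)%N) F j k =
     (c / b * (j%:R * (1 - mu) ^+ j.-1) + (1 - a) ^+ j) *
     \sum_(j.+1 <= k < n.+1) b * (1 - b) ^+ (k - j).-1.
    rewrite big_geq_mkord mulr_sumr; apply: eq_bigr => k _.
    by rewrite /F mulrDl.
  apply: ler_piMr; last by apply: sum_geometric_tail_le1 => //; rewrite -ltnS.
  by rewrite addr_ge0// ?mulr_ge0 ?invr_ge0 ?ler0n ?exprn_ge0//; lra.
rewrite big_split /= lerD2r -mulr_sumr; apply: ler_wpM2l.
  by rewrite mulr_ge0 ?invr_ge0//; lra.
exact: sum_ord_mulX_le.
Qed.

(** Three blocks of [h] factors fit into [n - 3], one for each power of [n] to be absorbed below.
    The ratio 8 is attained at [n = 8], [h = 1]. *)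
Lemma third_split n : (6 <= n)%N -> exists h, [/\ (n <= 8 * h)%N, (h <= n)%N,
  (h * 2 <= n.-2)%N & [/\ (h * 3 <= n.-2.-1)%N, n.-1 = n.-2.+1 & (n.-2 <= n)%N]].
Proof. by move=> hn; exists (n %/ 3).-1; split; try split; lia. Qed.

(** All pairs have the same covariance, so [n ^ 2] takes the place of the sum over indices. Each
    factor [n] is absorbed by [n (1 - x) ^ h <= 8 geo n x]: three times in the main term, where the
    exponent gives another [n], and twice in the terms for the pair itself, hence 512 and 64. *)
Lemma current_cov_le n a b c : (6 <= n)%N -> 0 < a <= 1 -> 0 < b <= 1 ->
    a * b <= c -> c <= a -> c <= b ->
  n%:R ^+ 2 * ((1 - a - b + c) ^+ n.-2 - (1 - a) ^+ n.-1 * (1 - b) ^+ n.-1)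
  <= 512 * (c / b * geo n (Num.max a b) ^+ 2) + 64 * (geo n a + geo n b).
Proof.
move=> hn ha hb hab hca hcb; have hmu := maxr_itv01 ha hb.
have [ha' hb'] : 0 <= a <= 1 /\ 0 <= b <= 1 by split; lra.
set mu := Num.max a b in hmu *.
have hmub : b <= mu by rewrite /mu le_max lexx orbT.
have hc : 0 <= c by nra.
have [h [hnh hh h2n [h3n en n2n]]] := third_split hn.
have big x : 0 <= x <= 1 -> n%:R * (1 - x) ^+ h <= 8 * geo n x.
  move=> hx; have := geo_ge_mulX hh hx.
  have : n%:R <= 8 * h%:R :> R by rewrite -natrM ler_nat.
  have : 0 <= (1 - x) ^+ h by apply: exprn_ge0; lra.
  nra.
have hX0 x k : 0 <= x <= 1 -> 0 <= (1 - x) ^+ k by move=> ?; apply: exprn_ge0; lra.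
have sq x : 0 <= x <= 1 -> n%:R ^+ 2 * (x * (1 - x) ^+ n.-2) <= 64 * geo n x.
  move=> hx; have hb1 := big x hx.
  have : (1 - x) ^+ n.-2 <= ((1 - x) ^+ h) ^+ 2.
    by rewrite -exprM; apply: ler_wiXn2l; [lra|lra|].
  have g0 := geo_ge0 n hx; have g1 := geo_mul_le1 n hx.
  have p0 := hX0 x h hx; have n0 : 0 <= n%:R :> R by [].
  move=> le; apply: (@le_trans _ _ (x * (n%:R * (1 - x) ^+ h) ^+ 2)).
    by rewrite exprMn mulrCA ler_wpM2l ?ler_wpM2l ?exprn_ge0//; lra.
  apply: (@le_trans _ _ (x * (8 * geo n x) ^+ 2)).
    by rewrite ler_wpM2l ?lerXn2r ?nnegrE ?mulr_ge0//; lra.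
  by rewrite exprMn expr2; nra.
(* Since [b <= mu], one has [c <= c / b * mu]; the extra [mu] then cancels the third [geo] by
   [mu * geo n mu <= 1]. *)
have cube : n%:R ^+ 2 * (n.-2%:R * (c * (1 - mu) ^+ n.-2.-1)) <=
    512 * (c / b * geo n mu ^+ 2).
  have g0 := geo_ge0 n hmu; have g1 := geo_mul_le1 n hmu.
  have p0 := hX0 mu h hmu; have n0 : 0 <= n%:R :> R by [].
  have le : (1 - mu) ^+ n.-2.-1 <= ((1 - mu) ^+ h) ^+ 3.
    by rewrite -exprM; apply: ler_wiXn2l; [lra|lra|].
  have cb0 : 0 <= c / b by rewrite divr_ge0//; lra.
  apply: (@le_trans _ _ (c / b * (mu * (n%:R * (1 - mu) ^+ h) ^+ 3))).
    have -> : c / b * (mu * (n%:R * (1 - mu) ^+ h) ^+ 3) =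
        n%:R ^+ 2 * (n%:R * (c / b * mu * ((1 - mu) ^+ h) ^+ 3)).
      by rewrite exprMn; ring.
    rewrite ler_wpM2l ?exprn_ge0//.
    apply: ler_pM; [by []|by rewrite mulr_ge0 ?hX0|by rewrite ler_nat|].
    apply: ler_pM => //; first exact: hX0.
    by rewrite mulrAC ler_pdivlMr ?ler_wpM2l//; lra.
  have -> : 512 * (c / b * geo n mu ^+ 2) = c / b * (512 * geo n mu ^+ 2) by ring.
  rewrite ler_wpM2l//; apply: (@le_trans _ _ (mu * (8 * geo n mu) ^+ 3)).
    by rewrite ler_wpM2l ?lerXn2r ?nnegrE ?mulr_ge0 ?big//; lra.
  have -> : mu * (8 * geo n mu) ^+ 3 = 512 * geo n mu ^+ 2 * (mu * geo n mu) by ring.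
  exact: ler_piMr (mulr_ge0 (ler0n _ _) (exprn_ge0 _ g0)) g1.
have h1 := subrXX_cov_le n.-2 ha' hb' hab hca hcb; rewrite -/mu in h1.
have n20 : 0 <= n%:R ^+ 2 :> R by rewrite exprn_ge0.
have h2 : n%:R ^+ 2 * ((1 - a - b + c) ^+ n.-2 - ((1 - a) * (1 - b)) ^+ n.-2) <=
  512 * (c / b * geo n mu ^+ 2).
  by apply: le_trans cube; apply: ler_wpM2l.
have eX x : (1 - x) ^+ n.-1 = (1 - x) * (1 - x) ^+ n.-2 by rewrite -exprS -en.
rewrite !eX; rewrite exprMn in h2.
have sa := sq a ha'; have sb := sq b hb'.
move: h2 sa sb; have := hX0 a n.-2 ha'; have := hX0 b n.-2 hb'.
have : (1 - a) ^+ n.-2 <= 1 by apply: exprn_ile1; lra.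
have : (1 - b) ^+ n.-2 <= 1 by apply: exprn_ile1; lra.
set A := (1 - a) ^+ _; set B := (1 - b) ^+ _; set N2 := n%:R ^+ 2 in n20 *.
move=> B1 A1 B0 A0 h2 sa sb.
have k1 : N2 * (a * (A * B)) <= N2 * (a * A).
  by rewrite !ler_wpM2l ?ler_piMr//; lra.
have k2 : N2 * (b * (A * B)) <= N2 * (b * B).
  by rewrite !ler_wpM2l ?ler_piMl//; lra.
have k3 : 0 <= N2 * (a * b * (A * B)) by rewrite !mulr_ge0//; lra.
have -> : (1 - a) * A * ((1 - b) * B) = A * B - a * (A * B) - b * (A * B) + a * b * (A * B) by ring.
by lra.
Qed.

End covariance_pointwise.

(** * Sums over grid cells *)

Section grid.
Context {R : realFieldType} {d K : nat}.
Local Notation cell := {ffun 'I_d -> 'I_K}.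
Implicit Types (q t : R) (u v : cell).

(* A cell [u] is the product of the intervals ]u l * delta, (u l + 1) * delta]; with
   [q = exp (- delta)] these are its mass, the mass of the orthant strictly above it,
   and the mass of the intersection of two such orthants. *)
Definition cellw q u : R := \prod_l (q ^+ u l * (1 - q)).
Definition celltail q u : R := \prod_l q ^+ (u l).+1.
Definition celljoin q u v : R := \prod_l q ^+ (maxn (u l) (v l)).+1.

Lemma cellw_ge0 q u : 0 <= q <= 1 -> 0 <= cellw q u.
Proof.
by move=> hq; apply: prodr_ge0 => l _; rewrite mulr_ge0 ?exprn_ge0//; lra.
Qed.

Lemma sum_cell_prod (f : 'I_K -> R) :
  \sum_(u : cell) \prod_l f (u l) = (\sum_m f m) ^+ d.
Proof. by rewrite -(bigA_distr_bigA (fun _ => f)) prodr_const card_ord. Qed.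

Lemma sum_cell_prod2 (f : 'I_K -> 'I_K -> R) :
  \sum_(u : cell) \sum_(v : cell) \prod_l f (u l) (v l) = (\sum_m \sum_m' f m m') ^+ d.
Proof.
rewrite -sum_cell_prod; apply: eq_bigr => u _.
by rewrite (bigA_distr_bigA (fun l => f (u l))).
Qed.

Lemma sum_cellw_le1 q : 0 <= q <= 1 -> \sum_(u : cell) cellw q u <= 1.
Proof.
move=> hq; rewrite (sum_cell_prod (fun m => q ^+ m * (1 - q))) -mulr_suml mulrC.
apply: exprn_ile1; last exact: sum_geometric_le1.
by rewrite mulr_ge0 ?sumr_ge0 ?subr_ge0// => [|? _]; rewrite ?exprn_ge0//; lra.
Qed.

Lemma celltail_itv q u : 0 < q <= 1 -> 0 < celltail q u <= 1.
Proof.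
move=> hq; apply/andP; split.
  by apply: prodr_gt0 => l _; rewrite exprn_gt0//; lra.
by apply: prodr_ile1 => l _; rewrite exprn_ge0 ?exprn_ile1//; lra.
Qed.

Lemma celljoin_bounds q u v : 0 < q <= 1 ->
  [/\ celltail q u * celltail q v <= celljoin q u v,
      celljoin q u v <= celltail q u & celljoin q u v <= celltail q v].
Proof.
move=> hq; rewrite /celltail /celljoin -big_split /=.
have qX k : 0 <= q ^+ k by rewrite exprn_ge0//; lra.
have qle k k' : (k <= k')%N -> q ^+ k' <= q ^+ k by move=> ?; apply: ler_wiXn2l => //; lra.
split; apply: ler_prod => l _; rewrite -?exprD qX qle//; clear; lia.
Qed.

Lemma prodrX_mul (f : 'I_d -> nat) t k :
  (\prod_l t ^+ f l) ^+ k = \prod_l t ^+ (f l * k)%N.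
Proof. by rewrite -prodrXl; apply: eq_bigr => l _; rewrite -exprM. Qed.

Section scales.
Variables (n L : nat) (t : R).
Hypotheses (L6 : (6 <= L)%N) (nL : (n <= 2 ^ L)%N).
Hypotheses (t01 : 0 < t < 1) (tL : 2^-1 <= t ^+ (4 * L)).
(** With [q] a power of [t], the exponents [1 - 1 / L] and their halves become natural numbers. As
    [t ^ (4 * L) = q ^ 2], the hypothesis [tL] bounds by a factor 2 the cost of passing from upper
    to lower corners of cells. *)
Let q := t ^+ (2 * L).

Let t_gt0 : 0 < t. Proof. by case/andP: t01. Qed.
Let t_le1 : t <= 1. Proof. by case/andP: t01 => _ /ltW. Qed.
Let L_gt0 : (0 < L)%N. Proof. exact: leq_trans L6. Qed.

Lemma scale_itv : 0 < q <= 1.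
Proof. by rewrite /q exprn_gt0//= exprn_ile1// ltW. Qed.

Let tX01 k : 0 <= t ^+ k <= 1.
Proof. by rewrite exprn_ge0 ?exprn_ile1// ltW. Qed.

(** After [geo_le_interp] one coordinate contributes about [(1 - q) * \sum_m q ^ (m / L)], where
    [q ^ (1 / L) = t ^ 2] and [1 - q <= L (1 - t ^ 2)]. *)
Lemma sum_cellw_geo_le :
  \sum_(u : cell) cellw q u * geo n (celltail q u) <= 2 * (2 * L%:R) ^+ d.
Proof.
pose y u := \prod_l t ^+ (2 * (u l).+1).
have y01 u : 0 < y u <= 1.
  by rewrite prodr_gt0 ?prodr_ile1//= => l _; rewrite ?exprn_gt0.
have yE u : celltail q u = y u ^+ L.
  rewrite /y prodrX_mul; apply: eq_bigr => l _.
  by rewrite /q -exprM; congr (_ ^+ _); rewrite mulnAC.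
apply: (@le_trans _ _ (\sum_(u : cell)
    2 * \prod_l (q ^+ u l * (1 - q) / t ^+ (2 * (u l).+1 * L.-1)))).
  apply: ler_sum => u _; rewrite yE.
  have h : geo n (y u ^+ L) <= 2 / \prod_l t ^+ (2 * (u l).+1 * L.-1).
    by rewrite -prodrX_mul; exact: geo_le_interp L_gt0 nL (y01 u).
  rewrite big_split /= -/(cellw q u) prodfV mulrCA.
  apply: ler_wpM2l; last exact: h.
  by apply: cellw_ge0; have := scale_itv; lra.
rewrite -mulr_sumr ler_wpM2l//.
rewrite (sum_cell_prod (fun m => q ^+ m * (1 - q) / t ^+ (2 * m.+1 * L.-1))).
have e (m : 'I_K) : q ^+ m * (1 - q) / t ^+ (2 * m.+1 * L.-1) =
    (1 - q) / t ^+ (2 * L.-1) * (t ^+ 2) ^+ m.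
  have -> : q ^+ m = (t ^+ 2) ^+ m * t ^+ (2 * m * L.-1).
    by rewrite /q -!exprM -exprD; congr (_ ^+ _); move: L_gt0; clear; case: L => //= l _; nia.
  have -> : (2 * m.+1 * L.-1 = 2 * L.-1 + 2 * m * L.-1)%N by clear; nia.
  rewrite exprD; field; rewrite !expf_neq0//; exact: lt0r_neq0.
rewrite (eq_bigr _ (fun m _ => e m)) -mulr_sumr.
apply: lerXn2r; rewrite ?nnegrE.
- have t0 := ltW t_gt0; have q1 : 0 <= 1 - q by rewrite subr_ge0; case/andP: scale_itv.
  by rewrite mulr_ge0 ?divr_ge0 ?exprn_ge0// sumr_ge0// => m _; rewrite !exprn_ge0.
- by rewrite mulr_ge0.
have hs := sum_geometric_le1 K (tX01 2).
have hb : 1 - q <= L%:R * (1 - t ^+ 2).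
  by rewrite /q; apply: subr1X_le; rewrite t_le1 ltW.
have hT : 2^-1 <= t ^+ (2 * L.-1).
  apply: le_trans tL _; apply: ler_wiXn2l; rewrite ?t_le1 ?ltW//; clear; lia.
have hs0 : 0 <= \sum_(m < K) (t ^+ 2) ^+ m.
  by apply: sumr_ge0 => m _; case/andP: (tX01 2) => ? _; rewrite exprn_ge0.
rewrite mulrAC ler_pdivrMr; last by lra.
apply: (@le_trans _ _ (L%:R * (1 - t ^+ 2) * \sum_(m < K) (t ^+ 2) ^+ m)).
  by rewrite ler_wpM2r.
rewrite -mulrA; apply: (@le_trans _ _ L%:R).
  by rewrite ler_piMr.
have : 0 <= L%:R :> R by [].
nra.
Qed.

(** One coordinate of the summand, with [max(a, b) ^ 2] replaced by [a ^ (3 / 2) * b ^ (1 / 2)], up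
    to the factor [1 - 1 / L] in the exponents. *)
Let per_coord (m m' : nat) : R :=
  q ^+ m * (1 - q) * (q ^+ m' * (1 - q)) * (q ^+ (maxn m m').+1 / q ^+ m'.+1)
  * (t ^+ (3 * (m.+1 * L.-1)) * t ^+ (m'.+1 * L.-1))^-1.

(** Apart from the loss in [L], the exponent of [q] is [m + maxn m m' - 3 / 2 * m - 1 / 2 * m'],
    which is half of [|m - m'|] on both sides of the diagonal. The loss adds [3 m + m'] to the
    exponent of [t], rewritten as [4 m' + 3 (m - m')]: this gives the last factor, and [L - 3] when
    [m < m']. *)
Let per_coord_le m m' : per_coord m m' <=
  2 * (1 - q) ^+ 2 * (t ^+ (L - 3)) ^+ ((m - m') + (m' - m)) * (t ^+ 4) ^+ m'.
Proof.
have q0 : 0 < q by case/andP: scale_itv.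
have -> : per_coord m m' = (1 - q) ^+ 2 * (q ^+ (m + maxn m m') /
    (t ^+ (3 * (m.+1 * L.-1)) * t ^+ (m'.+1 * L.-1))).
  rewrite /per_coord exprD !exprS; field.
  by rewrite !expf_neq0 ?lt0r_neq0// ?exprn_gt0.
have -> : 2 * (1 - q) ^+ 2 * (t ^+ (L - 3)) ^+ ((m - m') + (m' - m)) * (t ^+ 4) ^+ m' =
  (1 - q) ^+ 2 * (2 * ((t ^+ (L - 3)) ^+ ((m - m') + (m' - m)) * (t ^+ 4) ^+ m')) by ring.
apply: ler_wpM2l; first exact: sqr_ge0.
rewrite ler_pdivrMr ?mulr_gt0 ?exprn_gt0//.
have hT : 2^-1 <= t ^+ (4 * L.-1).
  by apply: le_trans tL _; apply: ler_wiXn2l; rewrite ?t_le1 ?ltW//; clear; lia.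
set E := ((L - 3) * ((m - m') + (m' - m)) + 4 * m' + 3 * (m * L.-1) + m' * L.-1)%N.
have hE : q ^+ (m + maxn m m') <= t ^+ E.
  rewrite /q -exprM; apply: ler_wiXn2l; rewrite ?t_le1 ?ltW// /E.
  move: L6; clear; case: L => [//|[//|[//|l]]] _ /=.
  rewrite subSS subSS subSS subn0.
  by case: (leqP m m') => h; nia.
apply: le_trans hE _.
have -> : 2 * ((t ^+ (L - 3)) ^+ (m - m' + (m' - m)) * (t ^+ 4) ^+ m') *
  (t ^+ (3 * (m.+1 * L.-1)) * t ^+ (m'.+1 * L.-1)) = 2 * t ^+ (4 * L.-1) * t ^+ E.
  rewrite -!exprM -!mulrA -!exprD; congr (_ * _ ^+ _); rewrite /E; clear; lia.
have : 0 <= t ^+ E by rewrite exprn_ge0// ltW.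
nra.
Qed.

Let sum_per_coord_le : \sum_(m < K) \sum_(m' < K) per_coord m m' <= 16 * L%:R.
Proof.
have hq : 0 <= 1 - q by case/andP: scale_itv => _; rewrite subr_ge0.
rewrite exchange_big /=.
apply: (@le_trans _ _ (\sum_(m' < K) 16 * ((1 - q) * (t ^+ 4) ^+ m'))).
  apply: ler_sum => m' _.
  apply: (@le_trans _ _ (\sum_(m < K) 2 * (1 - q) ^+ 2 *
      (t ^+ (L - 3)) ^+ ((m - m') + (m' - m)) * (t ^+ 4) ^+ m')).
    by apply: ler_sum => m _; exact: per_coord_le.
  rewrite -mulr_suml -mulr_sumr.
  have h2 := sum_geometric_dist_le2 (tX01 (L - 3)) (ltnW (ltn_ord m')).
  (* This needs [2 L <= 4 (L - 3)], the origin of [6 <= L]. *)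
  have hb : 1 - q <= 4 * (1 - t ^+ (L - 3)).
    apply: le_trans (_ : 1 - t ^+ ((L - 3) * 4) <= _); last first.
      by apply: subr1X_le; rewrite t_le1 ltW.
    rewrite lerD2l lerN2 /q; apply: ler_wiXn2l; rewrite ?t_le1 ?ltW//.
    by move: L6; clear; lia.
  move: h2; set S := \sum_(m < K) _ => h2.
  have S0 : 0 <= S.
    by apply: sumr_ge0 => m _; case/andP: (tX01 (L - 3)) => ? _; rewrite exprn_ge0.
  have h3 : (1 - q) * S <= 8 by nra.
  have -> : 2 * (1 - q) ^+ 2 * S * (t ^+ 4) ^+ m' =
      2 * ((1 - q) * S) * ((1 - q) * (t ^+ 4) ^+ m') by ring.
  apply: ler_wpM2r; last by lra.
  by rewrite mulr_ge0// exprn_ge0// exprn_ge0// ltW.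
rewrite -mulr_sumr ler_wpM2l// -mulr_sumr.
have hb : 1 - q <= L%:R * (1 - t ^+ 4).
  apply: le_trans (_ : 1 - t ^+ (4 * L) <= _); last first.
    by apply: subr1X_le; rewrite t_le1 ltW.
  rewrite lerD2l lerN2 /q; apply: ler_wiXn2l; rewrite ?t_le1 ?ltW//.
  by clear; lia.
have hs := sum_geometric_le1 K (tX01 4).
move: hs; set S := \sum_(m < K) _ => hs.
have S0 : 0 <= S.
  by apply: sumr_ge0 => m _; case/andP: (tX01 4) => ? _; rewrite exprn_ge0.
apply: (@le_trans _ _ (L%:R * (1 - t ^+ 4) * S)); first exact: ler_wpM2r.
by rewrite -mulrA ler_piMr.
Qed.

Lemma sum_cellw2_join_le :
  \sum_(u : cell) \sum_(v : cell) cellw q u * cellw q v * (celljoin q u v / celltail q v *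
     geo n (Num.max (celltail q u) (celltail q v)) ^+ 2)
  <= 4 * (16 * L%:R) ^+ d.
Proof.
pose y u := \prod_l t ^+ (u l).+1.
have y01 u : 0 < y u <= 1.
  by rewrite prodr_gt0 ?prodr_ile1//= => l _; rewrite ?exprn_gt0.
have yE u : celltail q u = (y u ^+ 2) ^+ L.
  rewrite -exprM /y prodrX_mul; apply: eq_bigr => l _.
  by rewrite /q -exprM mulnC.
have G u v : geo n (Num.max (celltail q u) (celltail q v)) ^+ 2 <=
    4 * (y u ^+ (3 * L.-1) * y v ^+ L.-1)^-1.
  pose z := Num.max (y u) (y v).
  have z01 : 0 < z <= 1 by rewrite /z; case: (leP (y u) (y v)).
  have zu : y u <= z by rewrite /z le_max lexx.
  have zv : y v <= z by rewrite /z le_max lexx orbT.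
  have z201 : 0 < z ^+ 2 <= 1.
    by rewrite exprn_gt0 ?exprn_ile1//; lra.
  have -> : Num.max (celltail q u) (celltail q v) = (z ^+ 2) ^+ L.
    rewrite !yE /z; case: (leP (y u) (y v)) => h; apply/max_idPr || apply/max_idPl.
      by rewrite -!exprM lerXn2r ?nnegrE//; have := y01 u; have := y01 v; lra.
    by rewrite -!exprM lerXn2r ?nnegrE//; have := y01 u; have := y01 v; lra.
  have h := geo_le_interp L_gt0 nL z201.
  apply: (@le_trans _ _ ((2 / (z ^+ 2) ^+ L.-1) ^+ 2)).
    apply: lerXn2r; rewrite ?nnegrE//.
      by apply: geo_ge0; rewrite exprn_ge0 ?exprn_ile1//; lra.
    by rewrite divr_ge0// exprn_ge0//; lra.
  rewrite exprMn expr2 (_ : 2 * 2 = 4 :> R); last by ring.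
  rewrite ler_wpM2l// exprVn lef_pV2 ?posrE; last first.
  - by rewrite mulr_gt0 ?exprn_gt0//; have := y01 u; have := y01 v; lra.
  - by rewrite !exprn_gt0//; lra.
  have -> : ((z ^+ 2) ^+ L.-1) ^+ 2 = z ^+ (3 * L.-1) * z ^+ L.-1.
    by rewrite -!exprM -exprD; congr (_ ^+ _); clear; lia.
  have := y01 u; have := y01 v => hv hu.
  by apply: ler_pM; rewrite ?exprn_ge0 ?lerXn2r ?nnegrE//; lra.
apply: (@le_trans _ _ (\sum_(u : cell) \sum_(v : cell) 4 * \prod_l per_coord (u l) (v l))).
  apply: ler_sum => u _; apply: ler_sum => v _.
  have -> : \prod_l per_coord (u l) (v l) = cellw q u * cellw q v *
      (celljoin q u v / celltail q v) * (y u ^+ (3 * L.-1) * y v ^+ L.-1)^-1.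
    rewrite /cellw /celljoin /celltail /y !prodrX_mul -!prodfV -!big_split /=.
    rewrite -prodfV -big_split /=; apply: eq_bigr => l _; rewrite /per_coord.
    by congr (_ * (_ ^+ _ * _)^-1); rewrite mulnCA.
  have h0 : 0 <= cellw q u * cellw q v * (celljoin q u v / celltail q v).
    rewrite !mulr_ge0 ?cellw_ge0//; try (by case/andP: scale_itv => /ltW ->).
      by apply: prodr_ge0 => l _; rewrite exprn_ge0//; case/andP: scale_itv => /ltW.
    by rewrite invr_ge0; case/andP: (celltail_itv v scale_itv) => /ltW.
  by rewrite mulrA [leRHS]mulrCA; apply: ler_wpM2l.
rewrite (eq_bigr (fun u => 4 * \sum_(v : cell) \prod_l per_coord (u l) (v l))); last first.
  by move=> u _; rewrite mulr_sumr.
rewrite -mulr_sumr ler_wpM2l//.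
rewrite (sum_cell_prod2 (fun m m' : 'I_K => per_coord m m')).
apply: lerXn2r; rewrite ?nnegrE ?mulr_ge0//.
apply: sumr_ge0 => m _; apply: sumr_ge0 => m' _.
have q0 : 0 <= q by case/andP: scale_itv => /ltW.
have t0 := ltW t_gt0; have q1 : 0 <= 1 - q by rewrite subr_ge0; case/andP: scale_itv.
by rewrite /per_coord !mulr_ge0 ?invr_ge0 ?mulr_ge0 ?exprn_ge0.
Qed.

End scales.
End grid.

(** * Real-valued probabilities and independence *)

Section real_probability.
Context {R : realType} {dT : measure_display} {T : measurableType dT}.
Variable P : probability T R.
Implicit Types A B : set T.

Definition pr A : R := fine (P A).

Lemma prE A : measurable A -> P A = (pr A)%:E.
Proof. by move=> mA; rewrite /pr fineK// fin_num_measure. Qed.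

Lemma pr_ge0 A : 0 <= pr A.
Proof. exact: fine_ge0. Qed.

Lemma pr_le1 A : measurable A -> pr A <= 1.
Proof. by move=> mA; rewrite -lee_fin -prE// probability_le1. Qed.

Lemma prT : pr setT = 1.
Proof. by rewrite /pr probability_setT. Qed.

Lemma pr0 : pr set0 = 0.
Proof. by rewrite /pr measure0. Qed.

Lemma le_pr A B : measurable A -> measurable B -> A `<=` B -> pr A <= pr B.
Proof. by move=> mA mB AB; rewrite -lee_fin -!prE// le_measure ?inE. Qed.

Lemma prU A B : measurable A -> measurable B -> A `&` B = set0 ->
  pr (A `|` B) = pr A + pr B.
Proof.
move=> mA mB AB; apply/EFin_inj; rewrite EFinD -!prE//; last exact: measurableU.
by rewrite measureU.
Qed.

Lemma pr_setD A B : measurable A -> measurable B -> B `<=` A ->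
  pr (A `\` B) = pr A - pr B.
Proof.
move=> mA mB BA; have mD : measurable (A `\` B) by exact: measurableD.
apply/eqP; rewrite -subr_eq opprK; apply/eqP; rewrite -prU//; last by rewrite setDKI.
by rewrite setUC setDUK.
Qed.

Lemma prU_le A B : measurable A -> measurable B -> pr (A `|` B) <= pr A + pr B.
Proof.
move=> mA mB; have -> : A `|` B = A `|` (B `\` A).
  by apply/seteqP; split=> x /=; have [] := pselect (A x); tauto.
rewrite prU//; [|exact: measurableD|by apply/seteqP; split=> x //= []? []].
rewrite lerD2l; apply: le_pr => //; exact: measurableD.
Qed.

Lemma pr_bigsetU_le (I : Type) (s : seq I) (Q : pred I) (E : I -> set T) :
  (forall i, Q i -> measurable (E i)) ->
  pr (\big[setU/set0]_(i <- s | Q i) E i) <= \sum_(i <- s | Q i) pr (E i).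
Proof.
move=> mE; elim: s => [|i s IH]; first by rewrite !big_nil pr0.
rewrite !big_cons; case: ifP => // Qi; apply: le_trans (prU_le _ _) _.
- exact: mE.
- exact: bigsetU_measurable.
- by rewrite lerD2l.
Qed.

(** Upper half of the discretisation: [E] runs over cell events and [B] is the exceptional event;
    the [E i] may overlap. *)
Lemma pr_le_cover (I : finType) (E : I -> set T) A B :
  measurable A -> measurable B -> (forall i, measurable (E i)) ->
  (forall x, A x -> ~ B x -> exists i, E i x) -> pr A <= pr B + \sum_i pr (E i).
Proof.
move=> mA mB mE cov; have mU : measurable (\big[setU/set0]_i E i).
  exact: bigsetU_measurable.
apply: (@le_trans _ _ (pr (B `|` \big[setU/set0]_i E i))).
  apply: le_pr => //; first exact: measurableU.
  move=> x Ax; have [Bx|nBx] := pselect (B x); [by left|right].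
  by rewrite -bigcup_seq; have [i Eix] := cov _ Ax nBx; exists i => //=; rewrite mem_index_enum.
by apply: le_trans (prU_le _ _) _ => //; rewrite lerD2l; exact: pr_bigsetU_le.
Qed.

(** Lower half of the discretisation, with disjoint cell events and [A] enlarged by the exceptional
    event; it also serves the lower bound on [p]. *)
Lemma pr_ge_packing (I : finType) (E : I -> set T) A :
  measurable A -> (forall i, measurable (E i)) -> (forall i, E i `<=` A) ->
  (forall i j x, E i x -> E j x -> i = j) -> \sum_i pr (E i) <= pr A.
Proof.
move=> mA mE EA dis.
have -> : \sum_i pr (E i) = pr (\big[setU/set0]_i E i).
  elim: (index_enum I) (index_enum_uniq I) => [|i s IH]; first by rewrite !big_nil pr0.
  move=> /= /andP[his us]; rewrite !big_cons IH// prU//.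
    exact: bigsetU_measurable.
  apply/seteqP; split => x //= [Ex]; rewrite -bigcup_seq => -[j /= js Ejx].
  by move: his; rewrite (dis _ _ _ Ex Ejx) js.
apply: le_pr => //; first exact: bigsetU_measurable.
by rewrite -bigcup_seq => x [i _ /EA].
Qed.

End real_probability.

(** * Independence beyond the generating class *)

Section independence.
Context {R : realType} {dT : measure_display} {T : measurableType dT}.
Variable P : probability T R.
Local Notation pr := (pr P).

(* Differences suffice to reach the complement of a union of two orthants. *)
Inductive diff_closure (C : set T -> Prop) : set T -> Prop :=
| diff_base A : C A -> diff_closure C A
| diff_diff A B : diff_closure C A -> diff_closure C B -> B `<=` A ->
    diff_closure C (A `\` B).

Lemma diff_closure_measurable (C : set T -> Prop) A :
  (forall B, C B -> measurable B) -> diff_closure C A -> measurable A.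
Proof. by move=> mC; elim=> [B /mC//|B D _ mB _ mD _]; exact: measurableD. Qed.

(** For a fixed index both sides of the product formula turn nested differences into subtractions,
    so the formula passes to the closure one index at a time. *)
Lemma indep_diff_closure (C : nat -> set T -> Prop) :
  (forall i A, C i A -> measurable A) ->
  (forall (s : seq nat) (E : nat -> set T), uniq s ->
     (forall i, i \in s -> C i (E i)) ->
     pr (\big[setI/setT]_(i <- s) E i) = \prod_(i <- s) pr (E i)) ->
  forall (s : seq nat) (E : nat -> set T), uniq s ->
     (forall i, i \in s -> diff_closure (C i) (E i)) ->
     pr (\big[setI/setT]_(i <- s) E i) = \prod_(i <- s) pr (E i).
Proof.
move=> mC indC s E us sE.
(* [s1] lists the indices with sets in the closure and [s2] those confined to the base class; when
   the set at [i] is itself a base set, [i] moves from one list to the other. *)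
suff H s1 s2 : uniq (s1 ++ s2) -> (forall i, i \in s1 -> diff_closure (C i) (E i)) ->
    forall E', (forall i, i \in s2 -> C i (E' i)) ->
    pr ((\big[setI/setT]_(i <- s1) E i) `&` (\big[setI/setT]_(i <- s2) E' i))
    = (\prod_(i <- s1) pr (E i)) * \prod_(i <- s2) pr (E' i).
  by have := H s [::]; rewrite cats0 => /(_ us sE E); rewrite !big_nil setIT mulr1; apply.
elim: s1 s2 => [|i s1 IH] s2; first by move=> us2 _ E' h; rewrite !big_nil setTI mul1r; exact: indC.
move=> us12 h1 E' h2; rewrite !big_cons -setIA -mulrA.
set F := (X in _ `&` X); set pF := (X in _ = _ * X).
have us' : uniq (s1 ++ i :: s2) by rewrite -cat1s uniq_catCA.
have his : i \notin s1 /\ i \notin s2.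
  by move: us12 => /=; rewrite mem_cat negb_or => /andP[/andP[]].
have mF : measurable F.
  apply: measurableI; rewrite -bigcap_seq; apply: bigcap_measurableType => j /= js.
    by apply: (@diff_closure_measurable (C j)); [exact: mC|exact/h1/mem_behead].
  exact/mC/h2.
elim: (h1 i (mem_head _ _)) => [A CA|A B dA HA dB HB BA].
  pose E'' k := if k == i then A else E' k.
  have h2' k : k \in i :: s2 -> C k (E'' k).
    rewrite /E'' inE; case: eqP => [-> _//|_ /= ks]; exact: h2.
  have := IH _ us' (fun k ks => h1 k (mem_behead (s := i :: s1) ks)) _ h2'.
  rewrite !big_cons /E'' eqxx.
  have eq k : k \in s2 -> (if k == i then A else E' k) = E' k.
    by case: eqP => // -> ; move: his => [_ /negbTE ->].
  rewrite (eq_big_seq _ eq) setICA => ->; rewrite mulrCA; congr (_ * (_ * _)).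
  by apply: eq_big_seq => k ks; rewrite eq.
have mA := diff_closure_measurable (mC i) dA; have mB := diff_closure_measurable (mC i) dB.
have -> : (A `\` B) `&` F = (A `&` F) `\` (B `&` F).
  by apply/seteqP; split => x /=; tauto.
rewrite !pr_setD//; [by rewrite HA HB mulrBl|exact: measurableI|exact: measurableI|].
by move=> x [/BA].
Qed.

End independence.

(** * Tails of an exponential variable *)

Section exponential_tail.
Context {R : realType} {dT : measure_display} {T : measurableType dT}.
Variables (P : probability T R) (Y : T -> R).
Hypotheses (mY : measurable_fun setT Y) (eY : exp1_distributed P Y).
Local Notation pr := (pr P).

Lemma measurable_preimageT (V : set R) : measurable V -> measurable (Y @^-1` V).
Proof. by move=> mV; rewrite -[_ @^-1` _]setTI; exact: mY. Qed.

Lemma exp1_tail x : 0 <= x -> pr (Y @^-1` `]x, +oo[) = expR (- x).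
Proof.
move=> x0.
have neg : pr (Y @^-1` `]-oo, 0[) = 0.
  rewrite /pr eY//= /exponential_prob integral0_eq// => y /=.
  by rewrite in_itv /= => y0; rewrite lt0_exponential_pdf.
have -> : Y @^-1` `]x, +oo[ = setT `\` Y @^-1` `]-oo, x].
  by apply/seteqP; split => w /=; rewrite !in_itv /= andbT ltNge; [move=> /negP|case=> _ /negP].
rewrite pr_setD//; last by apply: measurable_preimageT.
rewrite prT; suff -> : pr (Y @^-1` `]-oo, x]) = 1 - expR (- x) by ring.
have -> : Y @^-1` `]-oo, x] = (Y @^-1` `]-oo, 0[) `|` (Y @^-1` `[0, x]).
  apply/seteqP; split => w /=; rewrite !in_itv /=.
    by case: (ltP (Y w) 0) => [|_ ->]; [left|right].
  by case=> [/ltW/le_trans|/andP[]//]; apply.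
rewrite prU//; [|exact: measurable_preimageT..|]; last first.
  by apply/seteqP; split => w //=; rewrite !in_itv /= => -[h /andP[]]; rewrite leNgt h.
rewrite neg add0r /pr eY//; move: x0; rewrite le_eqVlt => /predU1P[<-|x0].
  by rewrite set_itv1 /exponential_prob integral_set1 oppr0 expR0 subrr.
by rewrite exponential_prob_itv0c//= mulN1r.
Qed.

End exponential_tail.

(** * Boxes and independence of whole vectors *)

Section vectors.
Context {R : realType} {dT : measure_display} {T : measurableType dT}.
Variables (P : probability T R) (d : nat) (X : nat -> 'I_d -> T -> R).
Hypothesis mX : forall k j, measurable_fun setT (X k j).
Hypothesis eX : forall k j, exp1_distributed P (X k j).
Hypothesis iX : mutually_independent P (fun kj : nat * 'I_d => X kj.1 kj.2).
Local Notation pr := (pr P).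

Definition box (i : nat) (B : 'I_d -> set R) : set T :=
  [set w | forall l, B l (X i l w)].

Lemma boxE i B : box i B = \big[setI/setT]_l (X i l @^-1` B l).
Proof.
rewrite -bigcap_seq; apply/seteqP; split => w h l /=; first by move=> _; exact: h.
by apply: h => /=; rewrite mem_index_enum.
Qed.

Lemma box_measurable i B : (forall l, measurable (B l)) -> measurable (box i B).
Proof.
move=> mB; rewrite boxE; apply: bigsetI_measurable => l _.
exact: measurable_preimageT.
Qed.

Lemma pr_boxes (s : seq nat) (B : nat -> 'I_d -> set R) : uniq s ->
  (forall i l, measurable (B i l)) ->
  pr (\big[setI/setT]_(i <- s) box i (B i)) =
  \prod_(i <- s) \prod_l pr (X i l @^-1` B i l).
Proof.
move=> us mB; pose J := [seq (i, l) | i <- s, l <- index_enum 'I_d].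
have uJ : uniq J by apply: allpairs_uniq => //; [exact: index_enum_uniq|move=> [? ?] [? ?]].
have := iX (B := fun il => B il.1 il.2) uJ (fun il => mB il.1 il.2).
have -> : \bigcap_(i in [set` J]) (X i.1 i.2 @^-1` B i.1 i.2) =
    \big[setI/setT]_(i <- s) box i (B i).
  rewrite -bigcap_seq; apply/seteqP; split => w h.
    move=> i /= si l; apply: (h (i, l)) => /=.
    by apply/allpairsP; exists (i, l); rewrite /= si mem_index_enum.
  move=> [i l] /= /allpairsP[[i' l'] /= [si' _ [-> ->]]]; exact: h.
have mpre i l : measurable (X i l @^-1` B i l) by apply: measurable_preimageT.
move=> h; apply/EFin_inj; rewrite -prE; last first.
  by apply: bigsetI_measurable => i _; exact: box_measurable.
rewrite h big_allpairs_dep /= (eq_bigr (fun i => (\prod_l pr (X i l @^-1` B i l))%:E)).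
  by rewrite prodEFin.
move=> i _; rewrite -prodEFin; apply: eq_bigr => l _; exact: prE.
Qed.

Lemma pr_box i B : (forall l, measurable (B l)) ->
  pr (box i B) = \prod_l pr (X i l @^-1` B l).
Proof.
move=> mB; have := @pr_boxes [:: i] (fun _ => B) isT (fun _ => mB).
by rewrite !big_seq1.
Qed.

Definition is_box i (A : set T) : Prop :=
  exists B, (forall l, measurable (B l)) /\ A = box i B.

(** The closure is allowed because the event that a vector misses two orthants is not a box. *)
Lemma indep_vectors (s : seq nat) (E : nat -> set T) : uniq s ->
  (forall i, i \in s -> diff_closure (is_box i) (E i)) ->
  pr (\big[setI/setT]_(i <- s) E i) = \prod_(i <- s) pr (E i).
Proof.
apply: (indep_diff_closure (C := is_box)).
  by move=> i A [B [mB ->]]; exact: box_measurable.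
move=> {}s {}E us sE.
have [i|B hB] := @choice _ _ (fun i Bi =>
    (forall l, measurable (Bi l)) /\ (i \in s -> E i = box i Bi)).
  case: (boolP (i \in s)) => [/sE[Bi [mBi ->]]|_]; first by exists Bi.
  by exists (fun _ => setT).
rewrite (eq_big_seq (fun i => box i (B i))); last by move=> i /(hB i).2.
rewrite pr_boxes//; last by move=> i; exact: (hB i).1.
apply: eq_big_seq => i si; rewrite (hB i).2// pr_box//; exact: (hB i).1.
Qed.

End vectors.

(** * Discretisation *)

Section discretisation.
Context {R : realType} {dT : measure_display} {T : measurableType dT}.
Variables (P : probability T R) (d : nat) (X : nat -> 'I_d -> T -> R).
Hypothesis mX : forall k j, measurable_fun setT (X k j).
Hypothesis eX : forall k j, exp1_distributed P (X k j).
Hypothesis iX : mutually_independent P (fun kj : nat * 'I_d => X kj.1 kj.2).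
Local Notation pr := (pr P).

(** [D] is the set of competitors: those before [j] for a record, all of them for a current record.
    One discretisation then serves both counts. *)
Definition undominated (N : nat) (D : pred nat) (j : nat) : set T :=
  [set w | forall i, (i < N)%N -> i != j -> D i ->
     ~~ prec (fun l => X j l w) (fun l => X i l w)].

Lemma measurable_prec i j :
  measurable [set w | prec (fun l => X j l w) (fun l => X i l w)].
Proof.
have -> : [set w | prec (fun l => X j l w) (fun l => X i l w)] =
    \big[setI/setT]_l [set w | X j l w < X i l w].
  rewrite -bigcap_seq; apply/seteqP; split => w /=.
    by move=> /forallP h l _ /=; exact: h.
  by move=> h; apply/forallP => l; apply: h => /=; rewrite mem_index_enum.
apply: bigsetI_measurable => l _.
have := measurable_fun_ltr (mX j l) (mX i l).
by move=> /(_ measurableT [set true]); rewrite setTI; exact.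
Qed.

Lemma undominated_measurable N D j : measurable (undominated N D j).
Proof.
have -> : undominated N D j = \big[setI/setT]_(i <- iota 0 N | (i != j) && D i)
    ~` [set w | prec (fun l => X j l w) (fun l => X i l w)].
  rewrite -big_filter -bigcap_seq; apply/seteqP; split => w h i /=.
    rewrite mem_filter mem_iota /= add0n => /andP[/andP[ij Di] iN].
    by apply/negP; exact: h.
  move=> iN ij Di; apply/negP; apply: h => /=.
  by rewrite mem_filter mem_iota ij Di.
apply: bigsetI_measurable => i _; apply: measurableC; exact: measurable_prec.
Qed.

Section grid_events.
Variable delta : R.
Hypothesis delta_gt0 : 0 < delta.
Let q := expR (- delta).

Let q01 : 0 < q <= 1.
Proof. by rewrite /q expR_gt0 /= -[leRHS]expR0 ler_expR oppr_le0 ltW. Qed.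

(** Closed on the right, so that a point strictly beyond the upper end strictly exceeds every point
    of the interval, as [prec] demands. *)
Definition cell_itv (m : nat) : set R := `]m%:R * delta, m.+1%:R * delta]%classic.

Lemma grid_tail i l m : pr (X i l @^-1` `]m%:R * delta, +oo[) = q ^+ m.
Proof.
rewrite exp1_tail//; last by rewrite mulr_ge0// ltW.
by rewrite -mulrN expRM_natl.
Qed.

Lemma pr_cell_itv i l m : pr (X i l @^-1` cell_itv m) = q ^+ m * (1 - q).
Proof.
rewrite mulrBr mulr1 -exprSr -!(grid_tail i l) -pr_setD; last first.
- move=> w /=; rewrite !in_itv /= !andbT; apply: le_lt_trans.
  by rewrite ler_pM2r// ler_nat.
- exact: measurable_preimageT.
- exact: measurable_preimageT.
congr (pr _); rewrite /cell_itv; apply/seteqP; split => w /=; rewrite !in_itv /= !andbT.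
  by move=> /andP[-> h]; split => //; rewrite ltNge h.
by move=> [-> /negP]; rewrite -leNgt.
Qed.

Lemma cell_itv_inj m m' x : cell_itv m x -> cell_itv m' x -> m = m'.
Proof.
rewrite /cell_itv /= !in_itv /= => /andP[h1 h2] /andP[h3 h4].
have := lt_le_trans h1 h4; have := lt_le_trans h3 h2.
by rewrite !ltr_pM2r// !ltr_nat !ltnS => a b; apply/eqP; rewrite eqn_leq a b.
Qed.

Lemma cell_itv_exists K x : 0 < x -> x <= K%:R * delta ->
  exists m : 'I_K, cell_itv m x.
Proof.
elim: K => [|K IH] x0 xK; first by move: x0; rewrite ltNge; move: xK; rewrite mul0r => ->.
have [h|h] := leP x (K%:R * delta).
  by have [m hm] := IH x0 h; exists (widen_ord (leqnSn _) m).
by exists ord_max; rewrite /cell_itv /= in_itv /= h.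
Qed.

Definition orthant i (m : 'I_d -> nat) : set T :=
  box X i (fun l => `](m l)%:R * delta, +oo[%classic).

Lemma orthant_is_box i m : is_box X i (orthant i m).
Proof. by eexists; split; last by []. Qed.

Lemma pr_orthant i m : pr (orthant i m) = \prod_l q ^+ m l.
Proof. by rewrite /orthant (pr_box mX iX)//; apply: eq_bigr => l _; exact: grid_tail. Qed.

Lemma orthantI i m m' :
  orthant i (fun l => maxn (m l) (m' l)) = orthant i m `&` orthant i m'.
Proof.
have h a b x : ((maxn a b)%:R * delta < x) = (a%:R * delta < x) && (b%:R * delta < x).
  case: (leqP a b) => ab; apply/idP/andP => [hb|[]//]; split => //;
    by apply: le_lt_trans hb; rewrite ler_pM2r// ler_nat// ltnW.
apply/seteqP; split => w.
  by move=> hw; split => l; have /= := hw l; rewrite !in_itv /= !andbT h => /andP[].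
by move=> [h1 h2] l; have /= := h1 l; have /= := h2 l; rewrite !in_itv /= !andbT h => -> ->.
Qed.

Variable K : nat.
Local Notation cell := {ffun 'I_d -> 'I_K}.

Definition in_cell i (u : cell) : set T := box X i (fun l => cell_itv (u l)).
Definition above i (u : cell) : set T := orthant i (fun l => (u l).+1).

Lemma in_cell_is_box i u : is_box X i (in_cell i u).
Proof. by eexists; split; last by []; move=> l; rewrite /cell_itv. Qed.

Lemma pr_in_cell i u : pr (in_cell i u) = cellw q u.
Proof.
rewrite /in_cell (pr_box mX iX); last by move=> l; rewrite /cell_itv.
by apply: eq_bigr => l _; exact: pr_cell_itv.
Qed.

Lemma pr_above i u : pr (above i u) = celltail q u.
Proof. exact: pr_orthant. Qed.

(** The booleans tell which of the two vectors have [i] as a competitor. The complement of the union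
    of the two orthants is written with nested differences only, so that it lies in
    [diff_closure]. *)
Definition avoid i (b1 b2 : bool) (u v : cell) : set T :=
  match b1, b2 with
  | true, true => (setT `\` above i u) `\` (above i v `\` (above i u `&` above i v))
  | true, false => setT `\` above i u
  | false, true => setT `\` above i v
  | false, false => setT
  end.

Definition avoidw (b1 b2 : bool) (u v : cell) : R :=
  match b1, b2 with
  | true, true => 1 - celltail q u - celltail q v + celljoin q u v
  | true, false => 1 - celltail q u
  | false, true => 1 - celltail q v
  | false, false => 1
  end.

Lemma aboveI i u v : above i u `&` above i v =
  orthant i (fun l => (maxn (u l) (v l)).+1).
Proof.
rewrite /above -orthantI; congr (orthant _ _); apply/funext => l.
by rewrite maxnSS.
Qed.

Lemma setT_is_box i : is_box X i setT.
Proof. by exists (fun _ => setT); split => //; apply/seteqP; split. Qed.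

Lemma above_measurable i u : measurable (above i u).
Proof. by apply: box_measurable. Qed.

Lemma avoid_closure i b1 b2 u v : diff_closure (is_box X i) (avoid i b1 b2 u v).
Proof.
have dT' : diff_closure (is_box X i) setT by apply: diff_base; exact: setT_is_box.
have dA z : diff_closure (is_box X i) (above i z).
  by apply: diff_base; exact: orthant_is_box.
case: b1 b2 => [] [] //=; [|exact: diff_diff..].
apply: diff_diff; first exact: diff_diff.
  apply: diff_diff => //; first by rewrite aboveI; apply: diff_base; exact: orthant_is_box.
by move=> w /= [h1 h2]; split => // h3; apply: h2.
Qed.

Lemma pr_avoid i b1 b2 u v : pr (avoid i b1 b2 u v) = avoidw b1 b2 u v.
Proof.
have mA := above_measurable i.
case: b1 b2 => [] [] /=; rewrite ?prT ?pr_setD ?prT ?pr_above//.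
- by rewrite aboveI pr_orthant -/(celljoin q u v); ring.
- exact: measurableI.
- exact: measurableD.
- by apply: measurableD => //; exact: measurableI.
- by move=> w /= [h1 h2]; split => // h3; apply: h2.
Qed.

End grid_events.
End discretisation.

(** * Comparison of domination with the grid *)

Section coupling.
Context {R : realType} {dT : measure_display} {T : measurableType dT}.
Variables (P : probability T R) (d : nat) (X : nat -> 'I_d -> T -> R).
Hypothesis mX : forall k j, measurable_fun setT (X k j).
Hypothesis eX : forall k j, exp1_distributed P (X k j).
Hypothesis iX : mutually_independent P (fun kj : nat * 'I_d => X kj.1 kj.2).
Local Notation pr := (pr P).

Variable delta : R.
Hypothesis delta_gt0 : 0 < delta.
Let q := expR (- delta).
Variables N K : nat.
Local Notation cell := {ffun 'I_d -> 'I_K}.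
Local Notation in_cell := (in_cell X delta).
Local Notation above := (above X delta).
Local Notation avoid := (avoid X delta).
Local Notation avoidw := (avoidw delta).

Let q01 : 0 < q <= 1.
Proof. by rewrite /q expR_gt0 /= -[leRHS]expR0 ler_expR oppr_le0 ltW. Qed.

Definition off_grid (i : nat) (l : 'I_d) : set T :=
  (setT `\` X i l @^-1` `]0%:R * delta, +oo[) `|` X i l @^-1` `]K%:R * delta, +oo[.

(** A shared interval in a single coordinate already counts, since the grid then does not order the
    two vectors in that coordinate. *)
Definition same_cell (i i' : nat) (l : 'I_d) (m : nat) : set T :=
  X i l @^-1` cell_itv delta m `&` X i' l @^-1` cell_itv delta m.

(* Outside this event every coordinate of the first [N] vectors lies on the grid
   and no two of them share a cell, so cells determine domination exactly. *)
Definition bad : set T :=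
  (\big[setU/set0]_(i < N) \big[setU/set0]_l off_grid i l) `|`
  (\big[setU/set0]_(i < N) \big[setU/set0]_(i' < N | i' != i)
     \big[setU/set0]_l \big[setU/set0]_(m < K) same_cell i i' l m).

Lemma cell_itv_measurable m : measurable (cell_itv delta m).
Proof. by rewrite /cell_itv. Qed.

Lemma off_grid_measurable i l : measurable (off_grid i l).
Proof.
by apply: measurableU; [apply: measurableD => //|]; exact: measurable_preimageT.
Qed.

Lemma same_cell_measurable i i' l m : measurable (same_cell i i' l m).
Proof.
by apply: measurableI; apply: measurable_preimageT => //; exact: cell_itv_measurable.
Qed.

Lemma bad_measurable : measurable bad.
Proof.
apply: measurableU; apply: bigsetU_measurable => i _.
  by apply: bigsetU_measurable => l _; exact: off_grid_measurable.
apply: bigsetU_measurable => i' _; apply: bigsetU_measurable => l _.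
by apply: bigsetU_measurable => m _; exact: same_cell_measurable.
Qed.

Lemma pr_off_grid i l : pr (off_grid i l) <= q ^+ K.
Proof.
have mO m : measurable (X i l @^-1` `]m%:R * delta, +oo[).
  exact: measurable_preimageT.
apply: le_trans (prU_le P _ _) _ => //; first exact: measurableD.
by rewrite pr_setD// prT !(grid_tail mX eX)// expr0 subrr add0r.
Qed.

Lemma pr_same_cell i i' l m : i != i' ->
  pr (same_cell i i' l m) = (q ^+ m * (1 - q)) ^+ 2.
Proof.
move=> ii'; have uJ : uniq [:: (i, l); (i', l)].
  by rewrite /= inE xpair_eqE negb_and ii'.
have := iX (B := fun _ => cell_itv delta m) uJ (fun _ => cell_itv_measurable m).
rewrite bigcap_seq !big_cons !big_nil setIT mule1 /= -/(same_cell i i' l m).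
have mC k : measurable (X k l @^-1` cell_itv delta m).
  by apply: measurable_preimageT => //; exact: cell_itv_measurable.
rewrite (prE P (same_cell_measurable i i' l m)) !(prE P (mC _)) => -[->].
by rewrite !(pr_cell_itv mX eX)// expr2.
Qed.

(** Two exponential coordinates lie in a common interval with probability at most the largest mass
    [1 - q] of an interval; leaving the grid costs [q ^ K] per coordinate. *)
Lemma pr_bad : pr bad <= (N * d)%:R * q ^+ K + (N * N * d)%:R * (1 - q).
Proof.
have q1 : 0 <= 1 - q by rewrite subr_ge0; case/andP: q01.
have m1 i : measurable (\big[setU/set0]_l off_grid i l).
  by apply: bigsetU_measurable => l _; exact: off_grid_measurable.
have m2 i i' l : measurable (\big[setU/set0]_(m < K) same_cell i i' l m).
  by apply: bigsetU_measurable => m _; exact: same_cell_measurable.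
have m3 i i' : measurable (\big[setU/set0]_l \big[setU/set0]_(m < K) same_cell i i' l m).
  by apply: bigsetU_measurable => l _.
have m4 i : measurable (\big[setU/set0]_(i' < N | i' != i)
     \big[setU/set0]_l \big[setU/set0]_(m < K) same_cell i i' l m).
  by apply: bigsetU_measurable => i' _.
apply: le_trans (prU_le P _ _) _; [by apply: bigsetU_measurable|by apply: bigsetU_measurable|].
apply: lerD.
  apply: le_trans (pr_bigsetU_le P _ _) _ => //.
  apply: (@le_trans _ _ (\sum_(i < N) \sum_(l < d) q ^+ K)); last first.
    by rewrite !sumr_const !card_ord -mulrnA -[leLHS]mulr_natl mulnC lexx.
  apply: ler_sum => i _; apply: le_trans (pr_bigsetU_le P _ _) _.
    by move=> l _; exact: off_grid_measurable.
  by apply: ler_sum => l _; exact: pr_off_grid.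
apply: le_trans (pr_bigsetU_le P _ _) _ => //.
apply: (@le_trans _ _ (\sum_(i < N) \sum_(i' < N) \sum_(l < d) (1 - q))); last first.
  have e : (d * N * N = N * N * d)%N by rewrite -mulnA mulnC.
  by rewrite !sumr_const !card_ord -!mulrnA -[leLHS]mulr_natl ?mulnA e lexx.
apply: ler_sum => i _; apply: le_trans (pr_bigsetU_le P _ _) _ => //.
rewrite [leRHS](bigID (fun i' : 'I_N => i' != i)) /= -[leLHS]addr0; apply: lerD; last first.
  by apply: sumr_ge0 => i' _; apply: sumr_ge0.
apply: ler_sum => i' ii'; apply: le_trans (pr_bigsetU_le P _ _) _ => //.
apply: ler_sum => l _; apply: le_trans (pr_bigsetU_le P _ _) _.
  by move=> m _; exact: same_cell_measurable.
have h := @sum_geometric_le1 R K q.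
apply: (@le_trans _ _ (\sum_(m < K) (1 - q) * ((1 - q) * q ^+ m))).
  apply: ler_sum => m _; rewrite pr_same_cell 1?eq_sym//.
  have : 0 <= q ^+ m <= 1 by rewrite exprn_ge0 ?exprn_ile1//; case/andP: q01 => // /ltW.
  move=> /andP[x0 x1].
  have -> : (q ^+ m * (1 - q)) ^+ 2 = (1 - q) * ((1 - q) * q ^+ m) * q ^+ m by ring.
  by rewrite ler_piMr// !mulr_ge0.
rewrite -!mulr_sumr ler_piMr// h//; case/andP: q01 => /ltW -> //.
Qed.

Lemma good_cell w i : ~ bad w -> (i < N)%N -> exists u : cell, in_cell i u w.
Proof.
move=> nb iN.
have [l|f hf] := @choice _ _ (fun l (m : 'I_K) => cell_itv delta m (X i l w)).
  have ng : ~ off_grid i l w.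
    move=> h; apply: nb; left; rewrite -bigcup_seq; exists (Ordinal iN) => /=.
      by rewrite mem_index_enum.
    by rewrite -bigcup_seq; exists l => //=; rewrite mem_index_enum.
  apply: cell_itv_exists.
    rewrite ltNge; apply/negP => h; apply: ng; left; split => //=.
    by rewrite in_itv /= mul0r andbT ltNge h.
  rewrite leNgt; apply/negP => h; apply: ng; right => /=.
  by rewrite in_itv /= andbT.
exists [ffun l => f l] => l; rewrite ffunE; exact: hf.
Qed.

Lemma good_distinct w i i' l (m : 'I_K) : ~ bad w -> (i < N)%N -> (i' < N)%N ->
  i != i' -> cell_itv delta m (X i l w) -> ~ cell_itv delta m (X i' l w).
Proof.
move=> nb iN i'N ii' h h'; apply: nb; right.
rewrite -bigcup_seq; exists (Ordinal iN); first by rewrite /= mem_index_enum.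
rewrite -big_filter -bigcup_seq; exists (Ordinal i'N).
  by rewrite /= mem_filter mem_index_enum andbT eq_sym.
rewrite -bigcup_seq; exists l; first by rewrite /= mem_index_enum.
by rewrite -bigcup_seq; exists m; first by rewrite /= mem_index_enum.
Qed.

(** Domination only places vector [i] beyond the lower ends of [u]; were it not beyond some upper
    end, the two vectors would share an interval. *)
Lemma prec_above w i j (u : cell) : ~ bad w -> (i < N)%N -> (j < N)%N -> i != j ->
  in_cell j u w -> prec (fun l => X j l w) (fun l => X i l w) <-> above i u w.
Proof.
move=> nb iN jN ij hj; split => [/forallP h l|h].
  rewrite /= in_itv /= andbT ltNge; apply/negP => hl.
  have := hj l; rewrite /cell_itv /= in_itv /= => /andP[h1 h2].
  apply: (good_distinct nb jN iN _ (hj l)); first by rewrite eq_sym.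
  by rewrite /cell_itv /= in_itv /= hl andbT (lt_trans h1)// h.
apply/forallP => l; have := h l; have := hj l.
by rewrite /cell_itv /= !in_itv /= andbT => /andP[_ h2]; exact: le_lt_trans.
Qed.

Lemma prod_avoidw_single (s : seq nat) (Q D : pred nat) (u : cell) :
  \prod_(i <- s | Q i) avoidw (D i) false u u =
  (1 - celltail q u) ^+ count (fun i => Q i && D i) s.
Proof.
elim: s => [|i s IH]; first by rewrite big_nil.
rewrite big_cons IH /=; case: (Q i) => /=; last by rewrite add0n.
by case: (D i) => /=; rewrite ?exprS ?mul1r.
Qed.

Let single_event (D : pred nat) j (u : cell) i : set T :=
  if i == j then in_cell j u else avoid i (D i) false u u.

Let pr_single D j (u : cell) : (j < N)%N ->
  pr (\big[setI/setT]_(i <- iota 0 N) single_event D j u i) =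
  cellw q u * (1 - celltail q u) ^+ count (fun i => (i != j) && D i) (iota 0 N).
Proof.
move=> jN; rewrite (indep_vectors mX iX) ?iota_uniq//; last first.
  move=> i _; rewrite /single_event; case: eqP => [->|_].
    by apply: diff_base; exact: in_cell_is_box.
  exact: avoid_closure.
rewrite (bigD1_seq j) ?iota_uniq ?mem_iota//=.
rewrite {1}/single_event eqxx (pr_in_cell mX eX iX)//; congr (_ * _).
rewrite -prod_avoidw_single; apply: eq_bigr => i ij.
by rewrite /single_event (negbTE ij) (pr_avoid mX eX iX).
Qed.

Lemma avoid_measurable i b1 b2 (u v : cell) : measurable (avoid i b1 b2 u v).
Proof.
have h : diff_closure (is_box X i) (avoid i b1 b2 u v) by exact: avoid_closure.
apply: diff_closure_measurable h => B [B' [mB' ->]]; exact: box_measurable.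
Qed.

Lemma in_cell_measurable i (u : cell) : measurable (in_cell i u).
Proof. by apply: box_measurable => // l; exact: cell_itv_measurable. Qed.

Let single_measurable D j u :
  measurable (\big[setI/setT]_(i <- iota 0 N) single_event D j u i).
Proof.
apply: bigsetI_measurable => i _; rewrite /single_event.
by case: ifP => _; [exact: in_cell_measurable|exact: avoid_measurable].
Qed.

Lemma undominated_le D j : (j < N)%N ->
  pr (undominated X N D j) <= pr bad + \sum_(u : cell) cellw q u *
    (1 - celltail q u) ^+ count (fun i => (i != j) && D i) (iota 0 N).
Proof.
move=> jN; under eq_bigr => u _ do rewrite -pr_single//.
apply: pr_le_cover => //; [exact: undominated_measurable|exact: bad_measurable|].
move=> w hw nb; have [u hu] := good_cell nb jN; exists u.
rewrite -bigcap_seq => i /=; rewrite mem_iota add0n => /= iN.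
rewrite /single_event; case: eqP => [_//|/eqP ij]; case Di : (D i) => //=.
split=> // ha; have := hw i iN ij Di; apply/negP; rewrite negbK.
exact/(prec_above nb iN jN ij hu).
Qed.

Lemma undominated_ge D j : (j < N)%N ->
  \sum_(u : cell) cellw q u *
    (1 - celltail q u) ^+ count (fun i => (i != j) && D i) (iota 0 N)
  <= pr (undominated X N D j) + pr bad.
Proof.
move=> jN; under eq_bigr => u _ do rewrite -pr_single//.
have mU := undominated_measurable mX N D j; have mB := bad_measurable.
apply: le_trans (prU_le P _ _) => //.
apply: pr_ge_packing => //; first exact: measurableU.
  move=> u w; rewrite -bigcap_seq => h.
  have [b|nb] := pselect (bad w); [by right|left] => i iN ij Di.
  have := h j; rewrite /= mem_iota add0n jN => /(_ isT); rewrite /single_event eqxx => hu.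
  have := h i; rewrite /= mem_iota add0n iN => /(_ isT).
  rewrite /single_event (negbTE ij) Di /= => -[_ ha].
  by apply/negP => /(prec_above nb iN jN ij hu).
move=> u v w; rewrite -!bigcap_seq => /(_ j) /= h /(_ j) /=.
move: h; rewrite mem_iota add0n jN /single_event eqxx => /(_ isT) hu /(_ isT) hv.
by apply/ffunP => l; apply/val_inj/(cell_itv_inj delta_gt0 (hu l) (hv l)).
Qed.

(** Covariances are only bounded above, so this is one-sided. The event [E] drops every relation
    between the vectors [j] and [k] themselves. *)
Lemma undominated_pair_le (D D' : pred nat) j k : (j < N)%N -> (k < N)%N -> j != k ->
  pr (undominated X N D j `&` undominated X N D' k) <= pr bad +
  \sum_(p : cell * cell) cellw q p.1 * cellw q p.2 *
    \prod_(i <- iota 0 N | (i != j) && (i != k)) avoidw (D i) (D' i) p.1 p.2.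
Proof.
move=> jN kN jk.
pose E (p : cell * cell) i : set T := if i == j then in_cell j p.1 else
  if i == k then in_cell k p.2 else avoid i (D i) (D' i) p.1 p.2.
have prE p : pr (\big[setI/setT]_(i <- iota 0 N) E p i) = cellw q p.1 * cellw q p.2 *
    \prod_(i <- iota 0 N | (i != j) && (i != k)) avoidw (D i) (D' i) p.1 p.2.
  rewrite (indep_vectors mX iX) ?iota_uniq//; last first.
    move=> i _; rewrite /E; case: eqP => [->|_]; last case: eqP => [->|_].
    - by apply: diff_base; exact: in_cell_is_box.
    - by apply: diff_base; exact: in_cell_is_box.
    - exact: avoid_closure.
  rewrite (bigD1_seq j) ?iota_uniq ?mem_iota//= -big_filter.
  rewrite (bigD1_seq k) ?filter_uniq ?iota_uniq ?mem_filter ?mem_iota 1?eq_sym ?jk//=.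
  rewrite -big_filter -filter_predI big_filter mulrA.
  rewrite {1 2}/E !eqxx [k == j]eq_sym (negbTE jk) !(pr_in_cell mX eX iX)//; congr (_ * _).
  apply: eq_big => i; first by rewrite /= andbC.
  by move=> /= /andP[ik ij]; rewrite /E (negbTE ij) (negbTE ik) (pr_avoid mX eX iX).
under eq_bigr => p _ do rewrite -prE.
apply: pr_le_cover => //.
- by apply: measurableI; exact: undominated_measurable.
- exact: bad_measurable.
- move=> p; apply: bigsetI_measurable => i _; rewrite /E.
  case: ifP => _; first exact: in_cell_measurable.
  by case: ifP => _; [exact: in_cell_measurable|exact: avoid_measurable].
move=> w [hj hk] nb.
have [u hu] := good_cell nb jN; have [v hv] := good_cell nb kN; exists (u, v).
rewrite -bigcap_seq => i /=; rewrite mem_iota add0n => /= iN.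
rewrite /E; case: eqP => [_//|/eqP ij]; case: eqP => [_//|/eqP ik] /=.
have nu : D i -> ~ above i u w.
  move=> Di ha; have := hj i iN ij Di; apply/negP; rewrite negbK.
  exact/(prec_above nb iN jN ij hu).
have nv : D' i -> ~ above i v w.
  move=> Di ha; have := hk i iN ik Di; apply/negP; rewrite negbK.
  exact/(prec_above nb iN kN ik hv).
case: (D i) (D' i) nu nv => [] [] nu nv //=.
- by split; [split => //; exact: nu|case=> h _; exact: (nv isT h)].
- by split => //; exact: nu.
- by split => //; exact: nv.
Qed.

End coupling.

(** * Numbers of competitors *)

Section counting.
Implicit Types (N a b i j k : nat).

Lemma count_itv_iota N a b :
  count (fun i => (a <= i < b)%N) (iota 0 N) = (minn b N - a)%N.
Proof.
elim: N => [|N IH]; first by rewrite minn0 sub0n.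
by rewrite -addn1 iotaD count_cat IH /= addn0 add0n; case: (boolP (_ <= _ < _)%N); lia.
Qed.

Lemma count_lt_iota N j : (j < N)%N ->
  count (fun i => (i != j) && (i < j)%N) (iota 0 N) = j.
Proof.
move=> jN; rewrite -[RHS](_ : minn j N - 0 = j)%N; last by lia.
rewrite -count_itv_iota; apply: eq_count => i; lia.
Qed.

Lemma count_lt2_iota N j k : (j < k < N)%N ->
  count (fun i => ((i != j) && (i != k)) && (i < j)%N) (iota 0 N) = j.
Proof.
move=> jN; rewrite -[RHS](_ : minn j N - 0 = j)%N; last by lia.
rewrite -count_itv_iota; apply: eq_count => i; lia.
Qed.

Lemma count_between_iota N j k : (j < k < N)%N ->
  count (fun i => ((i != j) && (i != k)) && ((i < k)%N && ~~ (i < j)%N)) (iota 0 N)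
  = (k - j).-1.
Proof.
move=> jN; rewrite -[RHS](_ : minn k N - j.+1 = _)%N; last by lia.
rewrite -count_itv_iota; apply: eq_count => i; lia.
Qed.

Lemma count_neq_iota N j : (j < N)%N ->
  count (fun i => (i != j) && true) (iota 0 N) = N.-1.
Proof.
move=> jN; have := count_predC (pred1 j) (iota 0 N).
rewrite size_iota count_uniq_mem ?iota_uniq// mem_iota jN /= => h.
by rewrite -[in RHS]h add1n /=; apply: eq_count => i /=; rewrite andbT.
Qed.

Lemma count_neq2_iota N j k : (j < N)%N -> (k < N)%N -> j != k ->
  count (fun i => ((i != j) && (i != k)) && true) (iota 0 N) = N.-2.
Proof.
move=> jN kN jk; have := count_predC (mem [:: j; k]) (iota 0 N).
have -> : count (mem [:: j; k]) (iota 0 N) = 2.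
  rewrite -[RHS]/(size [:: j; k]) -size_filter; apply/perm_size/uniq_perm.
  - by rewrite filter_uniq ?iota_uniq.
  - by rewrite /= inE jk.
  move=> i; rewrite mem_filter mem_iota /= add0n andb_idr// !inE.
  by move=> /orP[/eqP ->|/eqP ->].
rewrite size_iota => h; rewrite -[in RHS]h add2n /=; apply: eq_count => i /=.
by rewrite andbT !inE negb_or.
Qed.

End counting.

Lemma exprn_arbitrarily_small {R : realType} (q c e : R) : 0 < q < 1 -> 0 <= c -> 0 < e ->
  exists K, c * q ^+ K <= e.
Proof.
(* The witness comes from [K * (1 - q) * q ^ K <= 1], which [geo] provides. *)
move=> /andP[q0 q1] c0 e0; pose K := (Num.truncn (c / (e * (1 - q)))).+1.
have hK : c / (e * (1 - q)) < K%:R by exact: truncnS_gt.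
exists K; have hx : 0 <= 1 - q <= 1 by lra.
have := geo_ge_mulX (leqnn K) hx; rewrite subKr => h1.
have h2 := geo_mul_le1 K hx.
have e1 : 0 < e * (1 - q) by rewrite mulr_gt0//; lra.
move: hK; rewrite ltr_pdivrMr// => hK.
have qK : 0 <= q ^+ K by rewrite exprn_ge0// ltW.
apply: (@le_trans _ _ (K%:R * (e * (1 - q)) * q ^+ K)).
  by rewrite ler_wpM2r// ltW.
have -> : K%:R * (e * (1 - q)) * q ^+ K = e * ((1 - q) * (K%:R * q ^+ K)) by ring.
rewrite ler_piMr//; first exact: ltW.
apply: le_trans h2; rewrite ler_wpM2l//; lra.
Qed.

(** * One grid for all events, and the probabilities [p] *)

Section moments.
Context {R : realType} {dT : measure_display} {T : measurableType dT}.
Variables (P : probability T R) (d : nat) (X : nat -> 'I_d -> T -> R).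
Hypothesis mX : forall k j, measurable_fun setT (X k j).
Hypothesis eX : forall k j, exp1_distributed P (X k j).
Hypothesis iX : mutually_independent P (fun kj : nat * 'I_d => X kj.1 kj.2).
Local Notation pr := (pr P).
Local Notation cell K := {ffun 'I_d -> 'I_K}.

Lemma grid_exists N' L (e : R) : (0 < L)%N -> 0 < e -> exists (t : R) (K : nat) (delta : R),
  [/\ 0 < t < 1, 2^-1 <= t ^+ (4 * L), 0 < delta, expR (- delta) = t ^+ (2 * L) &
   forall N, (N <= N')%N -> pr (bad X delta N K) <= e].
Proof.
move=> L0 e0; pose M : R := (N' * N' * d)%:R.
have M0 : 0 <= M by [].
have L1 : 1 <= L%:R :> R by rewrite ler1n.
pose e1 : R := Num.min e 1.
have e10 : 0 < e1 <= 1 by rewrite /e1; case: (leP e 1); lra.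
have e1e : e1 <= e by rewrite /e1 ge_min lexx.
(* By Bernoulli, [t = 1 - r] has to satisfy [4 L r <= 1 / 2], for the lower bound on [t ^ (4 * L)],
   and [2 L r M <= e / 2], for the shared intervals. Capping [e] by 1 serves the first. *)
pose r : R := e1 / (8 * L%:R * (M + 1)).
have den : 8 <= 8 * L%:R * (M + 1) by nra.
have r0 : 0 < r by rewrite divr_gt0//; lra.
have rE : r * (8 * L%:R * (M + 1)) = e1 by rewrite /r divfK//; lra.
clearbody r e1.
pose t : R := 1 - r.
have rL : 8 * L%:R * r <= 1 by nra.
have rM : 8 * L%:R * r * M <= e1 by nra.
have r8 : r * 8 <= 1.
  by have : 0 <= r * (L%:R - 1); [rewrite mulr_ge0//; lra|lra].
have t0 : 0 < t by rewrite /t subr_gt0; lra.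
have t1 : t < 1 by rewrite /t gtrBl.
have t01 : 0 < t < 1 by rewrite t0 t1.
have t01' : 0 <= t <= 1 by case/andP: t01 => /ltW -> /ltW.
have tX k : 1 - t ^+ k <= k%:R * r.
  have := @subr1X_le R k 1 t t01'; rewrite mul1n expr1 /t; lra.
pose q : R := t ^+ (2 * L).
have q0 : 0 < q by rewrite exprn_gt0//; lra.
have q1 : q < 1 by rewrite /q exprn_ilt1 ?(ltW t0)// muln_eq0 /= -lt0n.
(* [K] is chosen last, once [q] is fixed, so that leaving the grid becomes unlikely. *)
have [K hK] : exists K, (N' * d)%:R * q ^+ K <= e / 2.
  by apply: exprn_arbitrarily_small; rewrite ?q0 ?divr_gt0.
exists t, K, (- ln q); split => //.
- by have := tX (4 * L)%N; rewrite natrM; lra.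
- by rewrite oppr_gt0 ln_lt0// q0.
- by rewrite opprK lnK// posrE.
move=> N NN'; have dl : 0 < - ln q by rewrite oppr_gt0 ln_lt0// q0.
apply: le_trans (pr_bad mX eX iX dl N K) _; rewrite opprK lnK ?posrE//.
have h1 : (N * d)%:R * q ^+ K <= e / 2.
  apply: le_trans hK; rewrite ler_wpM2r ?exprn_ge0 ?ler_nat ?leq_mul//; lra.
have h2 : (N * N * d)%:R * (1 - q) <= e / 2.
  apply: (@le_trans _ _ (M * (1 - q))).
    by rewrite ler_wpM2r ?ler_nat ?leq_mul//; lra.
  by have := tX (2 * L)%N; rewrite natrM -/q; nra.
by have -> : e = e / 2 + e / 2; [lra|exact: lerD].
Qed.

Definition cell_sum {K} (q : R) (c : nat) : R :=
  \sum_(u : cell K) cellw q u * (1 - celltail q u) ^+ c.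

(** Since [D] is contained in [D'], a competitor has to miss both orthants, only the second, or
    none. *)
Lemma prod_avoidw (delta : R) K (s : seq nat) (Q D D' : pred nat) (u v : cell K) :
  (forall i, D i -> D' i) ->
  let q := expR (- delta) in
  \prod_(i <- s | Q i) avoidw delta (D i) (D' i) u v =
  (1 - celltail q u - celltail q v + celljoin q u v) ^+ count (fun i => Q i && D i) s
  * (1 - celltail q v) ^+ count (fun i => Q i && (D' i && ~~ D i)) s.
Proof.
move=> DD' q; elim: s => [|i s IH]; first by rewrite big_nil /= !expr0 mulr1.
rewrite big_cons IH /=; case: (Q i) => //=.
case Di : (D i); first by rewrite (DD' _ Di) /= add0n exprS mulrA.
by case: (D' i) => /=; rewrite ?add0n ?mul1r// exprS mulrCA.
Qed.

Definition earlier j : pred nat := fun i => (i < j)%N.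

(* One grid on which all the events indexed by at most [N'] vectors have, up to [e],
   the probabilities of their discretisations. *)
Lemma fine_grid N' L (e : R) : (0 < L)%N -> 0 < e -> exists (t : R) (K : nat),
  let q := t ^+ (2 * L) in
  [/\ 0 < t < 1, 2^-1 <= t ^+ (4 * L),
   forall N D j, (N <= N')%N -> (j < N)%N ->
     `|pr (undominated X N D j) -
       @cell_sum K q (count (fun i => (i != j) && D i) (iota 0 N))| <= e,
   forall N j k, (N <= N')%N -> (j < k < N)%N ->
     pr (undominated X N (earlier j) j `&` undominated X N (earlier k) k) <= e +
     \sum_(p : cell K * cell K) cellw q p.1 * cellw q p.2 *
       ((1 - celltail q p.1 - celltail q p.2 + celljoin q p.1 p.2) ^+ j *
        (1 - celltail q p.2) ^+ (k - j).-1) &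
   forall N j k, (N <= N')%N -> (j < N)%N -> (k < N)%N -> j != k ->
     pr (undominated X N xpredT j `&` undominated X N xpredT k) <= e +
     \sum_(p : cell K * cell K) cellw q p.1 * cellw q p.2 *
       (1 - celltail q p.1 - celltail q p.2 + celljoin q p.1 p.2) ^+ N.-2].
Proof.
move=> L0 e0; have [t [K [delta [t01 tL d0 qE hb]]]] := grid_exists N' L0 e0.
exists t, K => q; rewrite -/q in qE; split => //.
- move=> N D j NN' jN; rewrite ler_norml -lerBlDr opprK lerBlDr.
  have hB := hb _ NN'.
  have := undominated_le mX eX iX d0 K D jN; have := undominated_ge mX eX iX d0 K D jN.
  rewrite qE -/(cell_sum _ _); lra.
- move=> N j k NN' /andP[jk kN].
  have jN : (j < N)%N := ltn_trans jk kN.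
  have := undominated_pair_le mX eX iX d0 K (earlier j) (earlier k) jN kN (negbT (ltn_eqF jk)).
  move/le_trans; apply; apply: lerD; first exact: hb.
  apply: ler_sum => p _; rewrite prod_avoidw; last by move=> i /ltn_trans; exact.
  by rewrite qE count_lt2_iota ?jk// count_between_iota ?jk.
- move=> N j k NN' jN kN jk.
  have := undominated_pair_le mX eX iX d0 K xpredT xpredT jN kN jk.
  move/le_trans; apply; apply: lerD; first exact: hb.
  apply: ler_sum => p _; rewrite (@prod_avoidw delta K _ _ xpredT xpredT)//.
  rewrite qE count_neq2_iota// (eq_count (a2 := pred0)) ?count_pred0 ?expr0 ?mulr1//.
  by move=> i; rewrite andbF.
Qed.

Definition undominated_prob m : R := pr (undominated X m.+1 (earlier m) m).
Local Notation p := undominated_prob.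

(** Only the number of competitors matters. Instead of permuting the joint law, both probabilities
    are approximated arbitrarily well by the same [cell_sum]. *)
Lemma pr_undominated N D j : (j < N)%N ->
  pr (undominated X N D j) = p (count (fun i => (i != j) && D i) (iota 0 N)).
Proof.
move=> jN; set c := count _ _.
apply/eqP; rewrite -subr_eq0 -normr_le0 leNgt; apply/negP => a0.
(* The error is a third of the gap, so two approximations cannot bridge it; the scale is [L = 1], as
   only the mesh matters here. *)
have [t [K [_ _ hg _ _]]] := fine_grid (N + c.+1) (ltn0Sn 0) (divr_gt0 a0 (ltr0Sn R 2)).
have := hg N D j (leq_addr _ _) jN; rewrite -/c.
have := hg c.+1 (earlier c) c (leq_addl _ _) (leqnn _); rewrite count_lt_iota// -/(p c).
move: a0; set A := pr _; set B := p c; set S := cell_sum _ _ => a0 h1 h2.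
have := ler_distD S A B; rewrite [`|S - B|]distrC; lra.
Qed.

End moments.

(** * Covariance bounds *)

Section moment_bounds.
Context {R : realType} {dT : measure_display} {T : measurableType dT}.
Variables (P : probability T R) (d : nat) (X : nat -> 'I_d -> T -> R).
Hypothesis mX : forall k j, measurable_fun setT (X k j).
Hypothesis eX : forall k j, exp1_distributed P (X k j).
Hypothesis iX : mutually_independent P (fun kj : nat * 'I_d => X kj.1 kj.2).
Local Notation pr := (pr P).
Local Notation cell K := {ffun 'I_d -> 'I_K}.
Local Notation p := (undominated_prob P X).
Local Notation cell_sum K := (@cell_sum R d K).

Lemma undominated_prob_itv m : 0 <= p m <= 1.
Proof. by rewrite pr_ge0 pr_le1//; exact: undominated_measurable. Qed.

Lemma pr_record N j : (j < N)%N -> pr (undominated X N (earlier j) j) = p j.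
Proof. by move=> jN; rewrite (pr_undominated mX eX iX)// count_lt_iota. Qed.

Lemma pr_current N j : (j < N)%N -> pr (undominated X N xpredT j) = p N.-1.
Proof. by move=> jN; rewrite (pr_undominated mX eX iX)// count_neq_iota. Qed.

Lemma cell_sum_mul K q c c' : cell_sum K q c * cell_sum K q c' =
  \sum_(x : cell K * cell K) cellw q x.1 * cellw q x.2 *
    ((1 - celltail q x.1) ^+ c * (1 - celltail q x.2) ^+ c').
Proof.
rewrite mulr_suml; under eq_bigr => u _ do rewrite mulr_sumr.
by rewrite pair_big /=; apply: eq_bigr => x _; ring.
Qed.

Lemma sum_cell_sum n K q :
  \sum_(j < n) cell_sum K q j = \sum_(u : cell K) cellw q u * geo n (celltail q u).
Proof.
by rewrite exchange_big /=; apply: eq_bigr => u _; rewrite mulr_sumr.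
Qed.

Lemma mul_approx (a b x y e : R) : 0 <= a <= 1 -> 0 <= b <= 1 -> 0 < e <= 1 ->
  0 <= x -> 0 <= y -> `|a - x| <= e -> `|b - y| <= e -> x * y - 3 * e <= a * b.
Proof.
rewrite !ler_norml => /andP[a0 a1] /andP[b0 b1] /andP[e0 e1] x0 y0 /andP[h1 h2] /andP[h3 h4].
have : x * y <= (a + e) * (b + e) by apply: ler_pM => //; lra.
have : a * e <= e by rewrite ler_piMl// ltW.
have : e * b <= e by rewrite ler_piMr// ltW.
have : e * e <= e by rewrite ler_piMr// ltW.
lra.
Qed.

Lemma cell_sum_ge0 K q c : 0 < q <= 1 -> 0 <= cell_sum K q c.
Proof.
move=> hq; apply: sumr_ge0 => u _; rewrite mulr_ge0 ?cellw_ge0 ?exprn_ge0//.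
  by case/andP: hq => /ltW ->.
by case/andP: (celltail_itv u hq) => _; rewrite subr_ge0.
Qed.

Section scale.
Variables n L : nat.
Hypotheses (L6 : (6 <= L)%N) (nL : (n <= 2 ^ L)%N).

Let L0 : (0 < L)%N. Proof. exact: leq_trans L6. Qed.
(** A pair costs [e] for the joint probability and [3 e] for the product of the marginals; over at
    most [n ^ 2] pairs this totals at most 1, the additive 1 in the bounds below. *)
Let e : R := (4 * n.+1%:R ^+ 2)^-1.
Let e0 : 0 < e. Proof. by rewrite invr_gt0 mulr_gt0// exprn_gt0. Qed.
Let e_n2 : 4 * e * n%:R ^+ 2 <= 1.
Proof.
have h : e * (4 * n.+1%:R ^+ 2) = 1 by rewrite /e mulVf// lt0r_neq0// mulr_gt0 ?exprn_gt0.
rewrite -[leRHS]h [leRHS]mulrA [4 * e]mulrC ler_wpM2l ?mulr_ge0 ?(ltW e0)//.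
by rewrite lerXn2r ?nnegrE// ler_nat.
Qed.
Let e_le1 : 0 < e <= 1.
Proof.
rewrite e0 /= invf_le1 ?mulr_gt0 ?exprn_gt0//.
have : 1 <= n.+1%:R ^+ 2 :> R by rewrite exprn_ege1// ler1n.
lra.
Qed.

Lemma sum_undominated_prob_le : \sum_(j < n) p j <= 2 * (2 * L%:R) ^+ d + 1.
Proof.
have [t [K /= [t01 tL hg _ _]]] := fine_grid mX eX iX n.+1 L0 e0.
set q := t ^+ (2 * L) in hg.
apply: (@le_trans _ _ (\sum_(j < n) (cell_sum K q j + e))).
  apply: ler_sum => j _; have jn : (j < n.+1)%N := ltnW (ltn_ord j).
  have := hg n.+1 (earlier j) j (leqnn _) jn; rewrite (pr_record jn) (count_lt_iota jn).
  by rewrite ler_norml => /andP[_]; rewrite lerBlDl addrC.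
rewrite big_split /= sumr_const card_ord sum_cell_sum; apply: lerD.
  exact: sum_cellw_geo_le.
rewrite -mulr_natl; apply: le_trans e_n2; rewrite mulrC expr2.
case: n => [|m]; first by rewrite !mulr0.
have : 1 <= m.+1%:R :> R by rewrite ler1n.
have := e0; nra.
Qed.

Lemma sum_cov_record_le :
  \sum_(k < n) \sum_(j < k)
    (pr (undominated X n (earlier j) j `&` undominated X n (earlier k) k) - p j * p k)
  <= 4 * (16 * L%:R) ^+ d + 2 * (2 * L%:R) ^+ d + 1.
Proof.
have [t [K /= [t01 tL hg hp _]]] := fine_grid mX eX iX n L0 e0.
set q := t ^+ (2 * L) in hg hp; have q01 : 0 < q <= 1 by exact: scale_itv.
pose F (x : cell K * cell K) (j k : nat) : R :=
 (1 - celltail q x.1 - celltail q x.2 + celljoin q x.1 x.2) ^+ j *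
   (1 - celltail q x.2) ^+ (k - j).-1 -
 (1 - celltail q x.1) ^+ j * (1 - celltail q x.2) ^+ k.
apply: (@le_trans _ _ (\sum_(k < n) \sum_(j < k)
    (\sum_x cellw q x.1 * cellw q x.2 * F x j k + 4 * e))).
  apply: ler_sum => k _; apply: ler_sum => j _.
  have jn : (j < n)%N := ltn_trans (ltn_ord j) (ltn_ord k).
  have h1 := hp n j k (leqnn _) (introT andP (conj (ltn_ord j) (ltn_ord k))).
  have hj := hg n (earlier j) j (leqnn _) jn.
  have hk := hg n (earlier k) k (leqnn _) (ltn_ord k).
  rewrite !pr_record ?count_lt_iota// in hj hk.
  have := mul_approx (undominated_prob_itv j) (undominated_prob_itv k) e_le1
    (cell_sum_ge0 K j q01) (cell_sum_ge0 K k q01) hj hk.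
  rewrite cell_sum_mul => h2.
  have -> : \sum_x cellw q x.1 * cellw q x.2 * F x j k =
    \sum_(x : cell K * cell K) cellw q x.1 * cellw q x.2 *
       ((1 - celltail q x.1 - celltail q x.2 + celljoin q x.1 x.2) ^+ j *
        (1 - celltail q x.2) ^+ (k - j).-1) -
    \sum_(x : cell K * cell K) cellw q x.1 * cellw q x.2 *
       ((1 - celltail q x.1) ^+ j * (1 - celltail q x.2) ^+ k).
    by rewrite -sumrB; apply: eq_bigr => x _; rewrite /F mulrBr.
  lra.
under eq_bigr => k _ do rewrite big_split /=.
rewrite big_split /=; apply: lerD; last first.
  apply: le_trans e_n2; rewrite expr2 mulrA !mulr_natr.
  apply: (@le_trans _ _ (\sum_(k < n) \sum_(j < n) 4 * e)).
    apply: ler_sum => k _; rewrite !sumr_const !card_ord ler_pMn2l ?mulr_gt0//.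
    exact: ltnW.
  by rewrite !sumr_const !card_ord.
apply: (@le_trans _ _ (\sum_(x : cell K * cell K) cellw q x.1 * cellw q x.2 *
    (celljoin q x.1 x.2 / celltail q x.2 *
       geo n (Num.max (celltail q x.1) (celltail q x.2)) ^+ 2 + geo n (celltail q x.1)))).
  under eq_bigr => k _ do rewrite exchange_big /=.
  rewrite exchange_big /=; apply: ler_sum => x _.
  under eq_bigr => k _ do rewrite -mulr_sumr.
  rewrite -mulr_sumr ler_wpM2l//.
    by rewrite mulr_ge0// cellw_ge0//; case/andP: q01 => /ltW ->.
  have [h1 h2 h3] := celljoin_bounds x.1 x.2 q01.
  by apply: record_cov_le => //; exact: celltail_itv.
under eq_bigr => x _ do rewrite mulrDr.
rewrite big_split /=; apply: lerD.
  rewrite -(pair_bigA _ (fun u v => cellw q u * cellw q v * (celljoin q u v /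
    celltail q v * geo n (Num.max (celltail q u) (celltail q v)) ^+ 2))) /=.
  exact: sum_cellw2_join_le.
rewrite -(pair_bigA _ (fun u v => cellw q u * cellw q v * geo n (celltail q u))) /=.
have := sum_cellw_geo_le L6 nL t01 tL (d := d) (K := K); rewrite -/q; apply: le_trans.
apply: ler_sum => u _; under eq_bigr => v _ do rewrite mulrAC.
rewrite -mulr_sumr ler_piMr//.
  rewrite mulr_ge0 ?cellw_ge0 ?geo_ge0//; first by case/andP: q01 => /ltW ->.
  by case/andP: (celltail_itv u q01) => /ltW ->.
by apply: sum_cellw_le1; case/andP: q01 => /ltW ->.
Qed.

Lemma sum_cov_current_le : (6 <= n)%N ->
  \sum_(k < n) \sum_(j < n | j != k)
    pr (undominated X n xpredT j `&` undominated X n xpredT k) - (n%:R * p n.-1) ^+ 2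
  <= 2048 * (16 * L%:R) ^+ d + 256 * (2 * L%:R) ^+ d + 1.
Proof.
move=> n6.
have [t [K /= [t01 tL hg _ hp]]] := fine_grid mX eX iX n L0 e0.
set q := t ^+ (2 * L) in hg hp; have q01 : 0 < q <= 1 by exact: scale_itv.
have n0 : (0 < n)%N := leq_trans (isT : (0 < 6)%N) n6.
pose S2 := \sum_(x : cell K * cell K) cellw q x.1 * cellw q x.2 *
       (1 - celltail q x.1 - celltail q x.2 + celljoin q x.1 x.2) ^+ n.-2.
pose S1 := \sum_(x : cell K * cell K) cellw q x.1 * cellw q x.2 *
       ((1 - celltail q x.1) ^+ n.-1 * (1 - celltail q x.2) ^+ n.-1).
have ww0 (x : cell K * cell K) : 0 <= cellw q x.1 * cellw q x.2.
  by rewrite mulr_ge0// cellw_ge0//; case/andP: q01 => /ltW ->.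
(* Nonnegativity of [S2] lets the [n (n - 1)] ordered pairs be counted as [n ^ 2], matching the
   square of the mean. *)
have S20 : 0 <= S2.
  apply: sumr_ge0 => x _; rewrite mulr_ge0// exprn_ge0//.
  have [h1 h2 h3] := celljoin_bounds x.1 x.2 q01.
  have i1 := celltail_itv x.1 q01; have i2 := celltail_itv x.2 q01.
  have := @inclusion_exclusion_le R (celltail q x.1) (celltail q x.2) (celljoin q x.1 x.2).
  by case/(_ _ _ _ _ _)/andP => //; [case/andP: i1 => /ltW ->|case/andP: i2 => /ltW ->].
have A1 : \sum_(k < n) \sum_(j < n | j != k)
    pr (undominated X n xpredT j `&` undominated X n xpredT k) <= n%:R ^+ 2 * (e + S2).
  apply: (@le_trans _ _ (\sum_(k < n) \sum_(j < n) (e + S2))); last first.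
    by rewrite !sumr_const !card_ord -mulrnA -[leLHS]mulr_natl natrM expr2 lexx.
  apply: ler_sum => k _; rewrite big_mkcond; apply: ler_sum => j _.
  by case: ifP => jk; [exact: hp|rewrite addr_ge0// ltW].
have A2 : n%:R ^+ 2 * (S1 - 3 * e) <= (n%:R * p n.-1) ^+ 2.
  rewrite exprMn ler_wpM2l ?exprn_ge0// expr2.
  have h := hg n xpredT 0%N (leqnn _) n0.
  rewrite pr_current// count_neq_iota// in h.
  rewrite /S1 -cell_sum_mul.
  exact: (mul_approx (undominated_prob_itv _) (undominated_prob_itv _) e_le1
    (cell_sum_ge0 _ _ q01) (cell_sum_ge0 _ _ q01) h h).
(* 2048 is 512 times the 4 of [sum_cellw2_join_le], and 256 is 64 times 2 for each of the two [geo]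
   sums. *)
have A3 : n%:R ^+ 2 * (S2 - S1) <= 2048 * (16 * L%:R) ^+ d + 256 * (2 * L%:R) ^+ d.
  rewrite /S2 /S1 -sumrB mulr_sumr.
  pose G2 (x : cell K * cell K) := celljoin q x.1 x.2 / celltail q x.2 *
       geo n (Num.max (celltail q x.1) (celltail q x.2)) ^+ 2.
  apply: (@le_trans _ _ (\sum_(x : cell K * cell K) cellw q x.1 * cellw q x.2 *
     (512 * G2 x + 64 * (geo n (celltail q x.1) + geo n (celltail q x.2))))).
    apply: ler_sum => x _; rewrite -mulrBr mulrCA ler_wpM2l//.
    have [h1 h2 h3] := celljoin_bounds x.1 x.2 q01.
    by apply: current_cov_le => //; exact: celltail_itv.
  have s1 : \sum_(x : cell K * cell K) cellw q x.1 * cellw q x.2 * G2 x <= 4 * (16 * L%:R) ^+ d.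
    rewrite -(pair_bigA _ (fun u v => cellw q u * cellw q v * G2 (u, v))) /=.
    exact: sum_cellw2_join_le.
  have sg := sum_cellw_geo_le L6 nL t01 tL (d := d) (K := K); rewrite -/q in sg.
  have sw : \sum_(u : cell K) cellw q u <= 1.
    by apply: sum_cellw_le1; case/andP: q01 => /ltW ->.
  have wg0 u : 0 <= cellw q u * geo n (celltail q u).
    rewrite mulr_ge0 ?cellw_ge0 ?geo_ge0//; first by case/andP: q01 => /ltW ->.
    by case/andP: (celltail_itv u q01) => /ltW ->.
  have s2 : \sum_(x : cell K * cell K) cellw q x.1 * cellw q x.2 *
      geo n (celltail q x.1) <= 2 * (2 * L%:R) ^+ d.
    rewrite -(pair_bigA _ (fun u v => cellw q u * cellw q v * geo n (celltail q u))) /=.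
    apply: le_trans sg; apply: ler_sum => u _; under eq_bigr => v _ do rewrite mulrAC.
    by rewrite -mulr_sumr ler_piMr.
  have s3 : \sum_(x : cell K * cell K) cellw q x.1 * cellw q x.2 *
      geo n (celltail q x.2) <= 2 * (2 * L%:R) ^+ d.
    rewrite -(pair_bigA _ (fun u v => cellw q u * cellw q v * geo n (celltail q v))).
    rewrite /= exchange_big /=.
    apply: le_trans sg; apply: ler_sum => u _; under eq_bigr => v _ do rewrite -mulrA.
    by rewrite -mulr_suml ler_piMl.
  have -> : \sum_(x : cell K * cell K) cellw q x.1 * cellw q x.2 *
     (512 * G2 x + 64 * (geo n (celltail q x.1) + geo n (celltail q x.2))) =
     512 * (\sum_(x : cell K * cell K) cellw q x.1 * cellw q x.2 * G2 x) +
     64 * (\sum_(x : cell K * cell K) cellw q x.1 * cellw q x.2 * geo n (celltail q x.1)) +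
     64 * (\sum_(x : cell K * cell K) cellw q x.1 * cellw q x.2 * geo n (celltail q x.2)).
    rewrite !mulr_sumr -!big_split /=; apply: eq_bigr => x _.
    by move: (G2 x) (geo _ _) (geo _ _) (cellw _ _) (cellw _ _) => G g1 g2 w1 w2; ring.
  lra.
have := e_n2; lra.
Qed.

End scale.
End moment_bounds.

(** * Orders of growth *)

Lemma sum_powers_ge {R : realFieldType} k l :
  l%:R ^+ k.+1 <= k.+1%:R * \sum_(i < l) i.+1%:R ^+ k :> R.
Proof.
elim: l => [|l IH]; first by rewrite big_ord0 mulr0 expr0n.
rewrite big_ord_recr /= mulrDr.
have h : l.+1%:R ^+ k.+1 - l%:R ^+ k.+1 <= k.+1%:R * (1 * l.+1%:R ^+ k) :> R.
  apply: (@subrXX_le R k.+1 l.+1%:R l%:R l.+1%:R 1); rewrite ?lexx ?ler0n ?ler_nat//=.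
  by rewrite natr1.
rewrite mul1r in h; lra.
Qed.

(** Bernoulli gives 1/2 for half the exponent; squaring gives 1/4. *)
Lemma subr1_pow2_ge {R : realFieldType} i : (0 < i)%N ->
  4^-1 <= (1 - 2^-1 ^+ i) ^+ (2 ^ i) :> R.
Proof.
case: i => // i _; set x := 1 - _.
have xh : 2^-1 <= x.
  have : 2^-1 ^+ i.+1 <= 2^-1 ^+ 1 :> R by rewrite ler_wiXn2l//; lra.
  by rewrite /x expr1; lra.
have xb : 0 <= x <= 1.
  have : 0 <= 2^-1 ^+ i.+1 :> R by rewrite exprn_ge0//; lra.
  by move: xh; rewrite /x; lra.
have h : 2^-1 <= x ^+ (2 ^ i).
  have := @subr1X_le R (2 ^ i) 1 x xb; rewrite mul1n expr1.
  have -> : (2 ^ i)%:R * (1 - x) = 2^-1 :> R.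
    rewrite /x subKr natrX exprS mulrCA -exprMn divff ?pnatr_eq0// expr1n; lra.
  lra.
rewrite expnS mulnC exprM expr2; have : 2^-1 * 2^-1 <= x ^+ (2 ^ i) * x ^+ (2 ^ i) :> R.
  by apply: ler_pM => //; lra.
lra.
Qed.

(** * Lower bounds on the record probabilities *)

Section lower_bounds.
Context {R : realType} {dT : measure_display} {T : measurableType dT}.
Variables (P : probability T R) (d' : nat) (X : nat -> 'I_d'.+1 -> T -> R).
Hypothesis mX : forall k j, measurable_fun setT (X k j).
Hypothesis eX : forall k j, exp1_distributed P (X k j).
Hypothesis iX : mutually_independent P (fun kj : nat * 'I_d'.+1 => X kj.1 kj.2).
Local Notation pr := (pr P).
Local Notation p := (undominated_prob P X).
Local Notation d := d'.+1.

(** The events defining [p m] and [p n] concern different vectors; as probabilities that vector 0 is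
    a current record they belong to nested events. *)
Lemma undominated_prob_nincr m n : (m <= n)%N -> p n <= p m.
Proof.
move=> mn; rewrite -(@pr_current R dT T P d X mX eX iX n.+1 0)//.
rewrite -(@pr_current R dT T P d X mX eX iX m.+1 0)//.
apply: le_pr; [exact: undominated_measurable..|].
by move=> w h i im; apply: h; exact: leq_trans im _.
Qed.

(** A coarse grid is enough for lower bounds; this one has [q = 1 / 2]. *)
Let delta : R := ln 2.
Let delta_gt0 : 0 < delta. Proof. by apply: ln_gt0; rewrite ltr1n. Qed.
Let qE : expR (- delta) = 2^-1. Proof. by rewrite expRN lnK// posrE. Qed.

(* The first [d - 1] coordinates range over width-[ln 2] cells of total index at most
   [i]; the last one is pushed beyond what is needed for the tail to be [2^-i]. *)
Lemma undominated_prob_pow2_ge i : (0 < i)%N ->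
  (i%:R / (2 * d%:R)) ^+ d' / (4 * 2 ^+ i) <= p (2 ^ i).
Proof.
(* [M] is large enough for [M ^ d'] to exceed [(i / d) ^ d'], and small enough for [d'] indices
   below it to sum to at most [i]. *)
move=> i0; pose M := (i %/ d).+1; pose N := (2 ^ i)%N.
pose V := {ffun 'I_d' -> 'I_M}.
pose top (f : V) := (i - \sum_l f l)%N.
have sumf (f : V) : (\sum_l f l <= i)%N.
  apply: (@leq_trans (\sum_(l < d') (i %/ d))).
    by apply: leq_sum => l _; rewrite -ltnS.
  rewrite sum_nat_const card_ord (leq_trans _ (leq_divM i d))// mulnC leq_mul//.
(* Lower corners, in contrast with [above]: whatever dominates a vector in the box of [B f] lies in
   this orthant, so missing it excludes domination outright, with no exceptional event. *)
pose m (f : V) (l : 'I_d) : nat := if unlift ord_max l is Some l' then f l' else top f.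
pose B (f : V) (l : 'I_d) : set R := if unlift ord_max l is Some l'
  then cell_itv delta (f l') else `](top f)%:R * delta, +oo[%classic.
have mB f l : measurable (B f l).
  by rewrite /B; case: unlift => [l'|]//; exact: cell_itv_measurable.
have prB f : pr (box X N (B f)) = 2^-1 ^+ d' * 2^-1 ^+ i.
  rewrite (pr_box mX iX)// (bigD1_ord ord_max)//= /B unlift_none.
  rewrite (grid_tail mX eX)// qE mulrC.
  rewrite (eq_bigr (fun l' : 'I_d' => 2^-1 ^+ f l' * 2^-1)); last first.
    by move=> l' _; rewrite liftK (pr_cell_itv mX eX)// qE; congr (_ * _); lra.
  rewrite big_split /= prodr_const card_ord.
  rewrite mulrAC mulrC; congr (_ * _); rewrite -[in RHS](subnK (sumf f)) exprD mulrC.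
  by congr (_ * _); elim/big_rec2: _ => [|l a b _ ->]; rewrite ?expr0// exprD.
have prO f k : pr (orthant X delta k (m f)) = 2^-1 ^+ i.
  rewrite (pr_orthant mX eX iX)// qE (bigD1_ord ord_max)//= /m unlift_none mulrC.
  rewrite (eq_bigr (fun l' : 'I_d' => 2^-1 ^+ f l')); last by move=> l' _; rewrite liftK.
  rewrite -[in RHS](subnK (sumf f)) exprD mulrC.
  by congr (_ * _); elim/big_rec2: _ => [|l a b _ ->]; rewrite ?expr0// exprD.
pose E (f : V) k := if k == N then box X N (B f) else setT `\` orthant X delta k (m f).
have mO f k : measurable (orthant X delta k (m f)) by apply: box_measurable.
have mE f k : measurable (E f k).
  by rewrite /E; case: ifP => _; [exact: box_measurable|exact: measurableD].
have prE f : pr (\big[setI/setT]_(k <- iota 0 N.+1) E f k) =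
    2^-1 ^+ d' * 2^-1 ^+ i * (1 - 2^-1 ^+ i) ^+ N.
  rewrite (indep_vectors mX iX) ?iota_uniq//; last first.
    move=> k _; rewrite /E; case: eqP => [->|_].
      by apply: diff_base; exists (B f).
    apply: diff_diff => //; first by apply: diff_base; exact: setT_is_box.
    by apply: diff_base; exact: orthant_is_box.
  rewrite -addn1 iotaD big_cat /= big_seq1 add0n {2}/E eqxx prB mulrC; congr (_ * _).
  rewrite (eq_big_seq (fun=> 1 - 2^-1 ^+ i)).
    have -> : iota 0 N = index_iota 0 N by rewrite /index_iota subn0.
    by rewrite big_mkord prodr_const card_ord.
  move=> k; rewrite mem_iota add0n => /= kN.
  by rewrite /E ltn_eqF// pr_setD// prT prO.
have imem k : (k < N.+1)%N -> k \in iota 0 N.+1 by rewrite mem_iota.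
have := @pr_ge_packing R dT T P V (fun f => \big[setI/setT]_(k <- iota 0 N.+1) E f k)
  (undominated X N.+1 (earlier N) N).
rewrite -/(p N) => H; apply: le_trans (H _ _ _ _); last first.
- move=> f g w; rewrite -!bigcap_seq => /(_ N (imem N (leqnn _))) hf /(_ N (imem N (leqnn _))) hg.
  rewrite /E eqxx in hf hg.
  apply/ffunP => l; apply/val_inj/(@cell_itv_inj R delta delta_gt0 _ _ (X N (lift ord_max l) w)).
    by have := hf (lift ord_max l); rewrite /B liftK.
  by have := hg (lift ord_max l); rewrite /B liftK.
- move=> f w; rewrite -bigcap_seq => h k kN kneN _.
  have := h k (imem k kN); rewrite /E (negbTE kneN) => -[_ nO].
  have := h N (imem N (leqnn _)); rewrite /E eqxx => hN.
  apply/negP => /forallP hprec; apply: nO => l /=; rewrite in_itv /= andbT.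
  apply: lt_trans (hprec l); have := hN l; rewrite /B /m.
  by case: unlift => [l'|]; rewrite /cell_itv /= in_itv /= ?andbT// => /andP[].
- by move=> f; apply: bigsetI_measurable => k _.
- exact: undominated_measurable.
rewrite (eq_bigr _ (fun f _ => prE f)) sumr_const card_ffun !card_ord -[leRHS]mulr_natl.
have h4 := @subr1_pow2_ge R i i0; rewrite -/N in h4.
have x0 : 0 <= 2^-1 ^+ i :> R by rewrite exprn_ge0.
have x1 : 0 <= 2^-1 ^+ d' :> R by rewrite exprn_ge0.
have -> : (i%:R / (2 * d%:R)) ^+ d' / (4 * 2 ^+ i) =
   (i%:R / d%:R) ^+ d' * (2^-1 ^+ d' * 2^-1 ^+ i * 4^-1) :> R.
  by rewrite !invfM !exprMn !exprVn; ring.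
apply: ler_pM; rewrite ?exprn_ge0 ?divr_ge0 ?mulr_ge0//.
  rewrite natrX lerXn2r ?nnegrE ?divr_ge0// ler_pdivrMr ?ltr0n// -natrM ler_nat.
  by rewrite /M ltnW// ltn_ceil.
by rewrite ler_wpM2l// mulr_ge0.
Qed.

(** A dyadic block holds [2 ^ l] terms, each at least a constant times [l.+1 ^ d' / 2 ^ l.+1], so it
    contributes order [l.+1 ^ d'], and these powers sum to order [l ^ d]. *)
Lemma sum_undominated_prob_pow2_ge l :
  l%:R ^+ d / (8 * d%:R * (2 * d%:R) ^+ d') <= \sum_(j < 2 ^ l) p j.
Proof.
have h : 8^-1 / (2 * d%:R) ^+ d' * (\sum_(i < l) i.+1%:R ^+ d') <= \sum_(j < 2 ^ l) p j.
  elim: l => [|l IH].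
    by rewrite big_ord0 mulr0; apply: sumr_ge0 => j _; case/andP: (undominated_prob_itv P mX j).
  rewrite big_ord_recr /= mulrDr -(big_mkord xpredT p).
  have ll : (2 ^ l <= 2 ^ l.+1)%N by rewrite leq_exp2l.
  rewrite (big_cat_nat _ ll)//=.
  apply: lerD; first by rewrite big_mkord.
  apply: (@le_trans _ _ (\sum_(2 ^ l <= j < 2 ^ l.+1) p (2 ^ l.+1)%N)); last first.
    rewrite !big_nat; apply: ler_sum => j /andP[_ jl]; exact/undominated_prob_nincr/ltnW.
  have l2 : (2 ^ l.+1 - 2 ^ l = 2 ^ l)%N by rewrite expnS mul2n -addnn addnK.
  rewrite sumr_const_nat l2 -[leRHS]mulr_natl natrX.
  apply: (@le_trans _ _ (2 ^+ l * ((l.+1%:R / (2 * d%:R)) ^+ d' / (4 * 2 ^+ l.+1)))); last first.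
    by rewrite ler_wpM2l ?exprn_ge0//; exact: undominated_prob_pow2_ge.
  rewrite le_eqVlt; apply/orP; left; apply/eqP.
  rewrite expr_div_n exprS.
  by field; rewrite !expf_neq0//= ?mulf_neq0 ?pnatr_eq0.
apply: le_trans h.
have := @sum_powers_ge R d' l; set S := \sum_(i < l) _ => hS.
have -> : l%:R ^+ d / (8 * d%:R * (2 * d%:R) ^+ d') =
   8^-1 / (2 * d%:R) ^+ d' * (l%:R ^+ d / d%:R) :> R.
  by rewrite !invfM; ring.
rewrite ler_wpM2l ?divr_ge0 ?exprn_ge0 ?mulr_ge0//.
by rewrite ler_pdivrMr ?ltr0n// mulrC.
Qed.

End lower_bounds.

Section orders_of_growth.
Context {R : realType} {dT : measure_display} {T : measurableType dT}.
Variables (P : probability T R) (d' : nat) (X : nat -> 'I_d'.+1 -> T -> R).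
Hypothesis mX : forall k j, measurable_fun setT (X k j).
Hypothesis eX : forall k j, exp1_distributed P (X k j).
Hypothesis iX : mutually_independent P (fun kj : nat * 'I_d'.+1 => X kj.1 kj.2).
Local Notation pr := (pr P).
Local Notation p := (undominated_prob P X).
Local Notation d := d'.+1.

(** The scale is [L = l + 7]; as [1 <= l] it is at most [8 l], whence [128 = 16 * 8]. Additive
    constants are absorbed by [1 <= x]. *)
Lemma upper_orders n (l := trunc_log 2 n) (x : R := (128 * l%:R) ^+ d) :
  (64 <= n)%N ->
  [/\ \sum_(j < n) p j <= 3 * x,
   \sum_(k < n) \sum_(j < k)
    (pr (undominated X n (earlier j) j `&` undominated X n (earlier k) k) - p j * p k)
    <= 7 * x &
   \sum_(k < n) \sum_(j < n | j != k)
    pr (undominated X n xpredT j `&` undominated X n xpredT k) - (n%:R * p n.-1) ^+ 2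
    <= 2305 * x].
Proof.
move=> n64; have l1 : (1 <= l)%N by apply: trunc_log_max => //; exact: leq_trans n64.
have nL : (n <= 2 ^ (l + 7))%N.
  apply: ltnW; apply: leq_trans (trunc_log_ltn n (isT : (1 < 2)%N)) _.
  by rewrite leq_exp2l// -addn1 leq_add2l.
have L6 : (6 <= l + 7)%N by rewrite (leq_trans _ (leq_addl _ _)).
have h16 : (16 * (l + 7)%:R) ^+ d <= x.
  rewrite /x lerXn2r ?nnegrE ?mulr_ge0// -!natrM ler_nat; move: l1; clear; lia.
have h2 : (2 * (l + 7)%:R) ^+ d <= x.
  rewrite /x lerXn2r ?nnegrE ?mulr_ge0// -!natrM ler_nat; move: l1; clear; lia.
have h1 : 1 <= x.
  rewrite /x exprn_ege1// -natrM ler1n; move: l1; clear; lia.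
have n6 : (6 <= n)%N by exact: leq_trans n64.
have a1 := sum_undominated_prob_le mX eX iX L6 nL.
have a2 := sum_cov_record_le mX eX iX L6 nL.
have a3 := sum_cov_current_le mX eX iX L6 nL n6.
move: a1 a2 a3; move: (_ ^+ d) (_ ^+ d) h16 h2 => u v hu hv a1 a2 a3; split.
- by apply: le_trans a1 _; lra.
- by apply: le_trans a2 _; lra.
- by apply: le_trans a3 _; lra.
Qed.

(** Monotonicity of [p] replaces [n.-1] by the next power of two, at the cost of a factor 2. The
    order is one power of the logarithm below that of the mean number of records. *)
Lemma current_order n (l := trunc_log 2 n) : (1 <= n)%N ->
  l%:R ^+ d' / (8 * (2 * d%:R) ^+ d') <= n%:R * p n.-1.
Proof.
move=> n1; have hn : (2 ^ l <= n)%N by exact: trunc_logP.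
have h := undominated_prob_pow2_ge mX eX iX (ltn0Sn l).
have hp : p (2 ^ l.+1)%N <= p n.-1.
  apply: (undominated_prob_nincr mX eX iX).
  exact: leq_trans (leq_pred _) (ltnW (trunc_log_ltn _ _)).
apply: (@le_trans _ _ (2 ^+ l * ((l.+1%:R / (2 * d%:R)) ^+ d' / (4 * 2 ^+ l.+1)))).
  have -> : 2 ^+ l * ((l.+1%:R / (2 * d%:R)) ^+ d' / (4 * 2 ^+ l.+1)) =
     l.+1%:R ^+ d' / (8 * (2 * d%:R) ^+ d') :> R.
    rewrite expr_div_n [2 ^+ l.+1]exprS.
    by field; rewrite !expf_neq0//= ?mulf_neq0 ?pnatr_eq0.
  rewrite ler_wpM2r ?invr_ge0 ?mulr_ge0 ?exprn_ge0 ?mulr_ge0//.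
  by rewrite lerXn2r ?nnegrE// ler_nat.
apply: ler_pM; rewrite ?exprn_ge0 ?divr_ge0 ?mulr_ge0 ?exprn_ge0 ?divr_ge0 ?mulr_ge0//.
  by rewrite -natrX ler_nat.
exact: le_trans hp.
Qed.

(** The difference is the sum of the nonnegative [p j - p n.-1]. If only [j < 2 ^ h] are kept, with
    [2 ^ h] about the square root of [n], the subtracted part is at most [n * p n.-1 / 2 ^ h], whose
    numerator is polylogarithmic, so the first sum prevails. *)
Lemma broken_order : exists (c : R) (n0 : nat), 0 < c /\ forall n, (n0 <= n)%N ->
  c * (trunc_log 2 n)%:R ^+ d <= \sum_(j < n) p j - n%:R * p n.-1.
Proof.
pose c1 : R := (8 * d%:R * (2 * d%:R) ^+ d')^-1.
have c10 : 0 < c1 by rewrite invr_gt0 !mulr_gt0 ?exprn_gt0 ?mulr_gt0// ltr0n.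
(* [A] is the ratio of [3 * (128 * l) ^ d], with [l] bounded by [3 h], to half of [c1 * h ^ d];
   since [2 ^ h] exceeds [A], the subtracted part is at most half of the main one. *)
pose A : R := 6 * 384 ^+ d / c1.
have A0 : 0 <= A.
  exact: divr_ge0 (mulr_ge0 (ler0n _ _) (exprn_ge0 _ (ler0n _ _))) (ltW c10).
pose h0 := (Num.truncn A).+1.
have hA : A < h0%:R by exact: truncnS_gt.
exists (c1 / 2 / 3 ^+ d), (maxn 64 (2 ^ (2 * h0))); split.
  by rewrite !divr_gt0// exprn_gt0.
move=> n; rewrite geq_max => /andP[n64 nh].
set l := trunc_log 2 n; pose h := l./2.
have lh : (2 * h0 <= l)%N by apply: trunc_log_max.
have hh0 : (h0 <= h)%N by rewrite /h; move: lh; clear; lia.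
have l3h : (l <= 3 * h)%N by move: hh0; rewrite /h /h0; clear; lia.
have h2l : (h + h <= l)%N by rewrite /h; clear; lia.
have h1 : (0 < h)%N by exact: leq_trans hh0.
have hn : (2 ^ h * 2 ^ h <= n)%N.
  have npos : (0 < n)%N := leq_trans (isT : (0 < 64)%N) n64.
  rewrite -expnD; apply: leq_trans (trunc_logP (isT : (1 < 2)%N) npos).
  by rewrite leq_exp2l.
have hn' : (2 ^ h <= n)%N.
  by apply: leq_trans hn; rewrite leq_pmulr// expn_gt0.
have p0 j : 0 <= p j by case/andP: (undominated_prob_itv P mX j).
have b1 : \sum_(j < 2 ^ h) p j - (2 ^ h)%:R * p n.-1 <= \sum_(j < n) p j - n%:R * p n.-1.
  have e m : \sum_(j < m) p j - m%:R * p n.-1 = \sum_(j < m) (p j - p n.-1).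
    by rewrite sumrB sumr_const card_ord mulr_natl.
  rewrite !e -!(big_mkord xpredT (fun j => p j - p n.-1)) (big_cat_nat _ hn')//=.
  rewrite lerDl big_nat; apply: sumr_ge0 => j /andP[_ jn]; rewrite subr_ge0.
  apply: (undominated_prob_nincr mX eX iX); rewrite -ltnS prednK//.
  exact: leq_ltn_trans jn.
have b2 := sum_undominated_prob_pow2_ge mX eX iX h.
have [b3 _ _] := upper_orders n64; rewrite -/l in b3.
have b4 : n%:R * p n.-1 <= \sum_(j < n) p j.
  rewrite -[n in n%:R]card_ord mulr_natl -sumr_const; apply: ler_sum => j _.
  by apply: (undominated_prob_nincr mX eX iX); rewrite -ltnS prednK// (leq_ltn_trans _ (ltn_ord j)).
have b5 : 2 ^+ h * ((2 ^ h)%:R * p n.-1) <= n%:R * p n.-1.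
  by rewrite mulrA ler_wpM2r// -natrX -natrM ler_nat.
have b6 : 3 * (128 * l%:R) ^+ d <= c1 * h0%:R / 2 * h%:R ^+ d.
  apply: (@le_trans _ _ (3 * (384 * h%:R) ^+ d)).
    apply: (ler_wpM2l (ler0n _ _)); apply: lerXn2r.
    - by rewrite nnegrE mulr_ge0 ?ler0n.
    - by rewrite nnegrE mulr_ge0 ?ler0n.
    - by rewrite -!natrM ler_nat; move: l3h; clear; lia.
  rewrite exprMn mulrA ler_wpM2r ?exprn_ge0//.
  have : A * c1 = 6 * 384 ^+ d by rewrite /A divfK// lt0r_neq0.
  have : A * c1 <= h0%:R * c1 by rewrite ler_pM2r// ltW.
  lra.
have b7 : (2 ^ h)%:R * p n.-1 <= c1 / 2 * h%:R ^+ d.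
  have k1 : h0%:R <= 2 ^+ h :> R by rewrite -natrX ler_nat (leq_trans hh0)// ltnW// ltn_expl.
  have k2 : 0 <= c1 / 2 * h%:R ^+ d by rewrite mulr_ge0 ?exprn_ge0 ?divr_ge0// ltW.
  have k3 : 0 < h0%:R :> R by rewrite ltr0n.
  have k4 : 0 < 2 ^+ h :> R by rewrite exprn_gt0.
  rewrite -(ler_pM2l k4); apply: le_trans b5 _; apply: le_trans b4 _.
  apply: le_trans b3 _; apply: le_trans b6 _.
  have -> : c1 * h0%:R / 2 * h%:R ^+ d = h0%:R * (c1 / 2 * h%:R ^+ d) by ring.
  exact: ler_wpM2r.
have b8 : c1 * h%:R ^+ d <= \sum_(j < 2 ^ h) p j by rewrite mulrC.
apply: le_trans b1; apply: (@le_trans _ _ (c1 / 2 * h%:R ^+ d)); last lra.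
rewrite -mulrA ler_wpM2l//; first by rewrite divr_ge0// ltW.
rewrite mulrC ler_pdivrMr ?exprn_gt0// -exprMn lerXn2r ?nnegrE ?mulr_ge0//.
by rewrite -natrM ler_nat mulnC.
Qed.

End orders_of_growth.

(** * Expectation and variance of bounded functions *)

Section bounded_expectation.
Context {R : realType} {dT : measure_display} {T : measurableType dT}.
Variable P : probability T R.
Local Notation pr := (pr P).
Implicit Types f g : T -> R.

Definition bounded_mfun f : Prop :=
  measurable_fun setT f /\ exists M, forall w, `|f w| <= M.

Definition Ex f : R := fine ('E_P[f])%E.

Lemma ExE f : Ex f = \int[P]_x f x.
Proof. by rewrite /Ex unlock. Qed.

Lemma bounded_mfun_integrable f : bounded_mfun f -> P.-integrable setT (EFin \o f).
Proof.
move=> [mf [M fM]]; apply: measurable_bounded_integrable => //.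
  by rewrite ltey_eq fin_num_measure.
exists M; split; first exact: num_real.
by move=> x Mx w _; apply: le_trans (fM w) (ltW Mx).
Qed.

Lemma bounded_mfunD f g : bounded_mfun f -> bounded_mfun g ->
  bounded_mfun (fun w => f w + g w).
Proof.
move=> [mf [M fM]] [mg [N gN]]; split; first exact: measurable_funD.
by exists (M + N) => w; apply: le_trans (ler_normD _ _) _; exact: lerD.
Qed.

Lemma bounded_mfunM f g : bounded_mfun f -> bounded_mfun g ->
  bounded_mfun (fun w => f w * g w).
Proof.
move=> [mf [M fM]] [mg [N gN]]; split; first exact: measurable_funM.
by exists (M * N) => w; rewrite normrM; apply: ler_pM.
Qed.

Lemma bounded_mfun_cst c : bounded_mfun (fun=> c).
Proof. by split; [exact: measurable_cst|exists `|c|]. Qed.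

Lemma bounded_mfunB f g : bounded_mfun f -> bounded_mfun g ->
  bounded_mfun (fun w => f w - g w).
Proof.
move=> bf bg.
have -> : (fun w => f w - g w) = (fun w => f w + (-1) * g w).
  by apply/funext => w; rewrite mulN1r.
by apply: bounded_mfunD => //; apply: bounded_mfunM => //; exact: bounded_mfun_cst.
Qed.

Lemma bounded_mfun_indic A : measurable A -> bounded_mfun (\1_A : T -> R).
Proof.
move=> mA; split; first exact: measurable_indic.
by exists 1 => w; rewrite indicE; case: (w \in A); rewrite ?normr1 ?normr0.
Qed.

Lemma bounded_mfun_sum (I : Type) (s : seq I) (F : I -> T -> R) :
  (forall i, bounded_mfun (F i)) -> bounded_mfun (fun w => \sum_(i <- s) F i w).
Proof.
move=> bF; elim: s => [|i s IH].
  by under eq_fun do rewrite big_nil; exact: bounded_mfun_cst.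
by under eq_fun do rewrite big_cons; exact: bounded_mfunD.
Qed.

Lemma ExD f g : bounded_mfun f -> bounded_mfun g ->
  Ex (fun w => f w + g w) = Ex f + Ex g.
Proof. by move=> bf bg; rewrite !ExE RintegralD//; exact: bounded_mfun_integrable. Qed.

Lemma ExB f g : bounded_mfun f -> bounded_mfun g ->
  Ex (fun w => f w - g w) = Ex f - Ex g.
Proof. by move=> bf bg; rewrite !ExE RintegralB//; exact: bounded_mfun_integrable. Qed.

Lemma ExZ c f : bounded_mfun f -> Ex (fun w => c * f w) = c * Ex f.
Proof. by move=> bf; rewrite !ExE RintegralZl//; exact: bounded_mfun_integrable. Qed.

Lemma Ex_cst c : Ex (fun=> c) = c.
Proof. by rewrite /Ex (expectation_cst P c). Qed.

Lemma le_Ex f g : bounded_mfun f -> bounded_mfun g -> (forall w, f w <= g w) ->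
  Ex f <= Ex g.
Proof.
by move=> bf bg fg; rewrite !ExE le_Rintegral//; exact: bounded_mfun_integrable.
Qed.

Lemma Ex_indic A : measurable A -> Ex (\1_A : T -> R) = pr A.
Proof. by move=> mA; rewrite /Ex expectation_indic. Qed.

Lemma Ex_sum (I : Type) (s : seq I) (F : I -> T -> R) :
  (forall i, bounded_mfun (F i)) ->
  Ex (fun w => \sum_(i <- s) F i w) = \sum_(i <- s) Ex (F i).
Proof.
move=> bF; elim: s => [|i s IH].
  by under eq_fun do rewrite big_nil; rewrite big_nil Ex_cst.
rewrite big_cons -IH -ExD//; last exact: bounded_mfun_sum.
by congr Ex; apply/funext => w; rewrite big_cons.
Qed.

Definition Var f : R := Ex (fun w => (f w - Ex f) ^+ 2).

Lemma bounded_mfun_center f c : bounded_mfun f -> bounded_mfun (fun w => (f w - c) ^+ 2).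
Proof.
move=> bf; have bc := bounded_mfunB bf (bounded_mfun_cst c).
exact: (bounded_mfunM bc bc).
Qed.

Lemma VarE f : bounded_mfun f -> Var f = Ex (fun w => f w ^+ 2) - Ex f ^+ 2.
Proof.
move=> bf; have b2 : bounded_mfun (fun w => f w ^+ 2) by exact: (bounded_mfunM bf bf).
have bz : bounded_mfun (fun w => (2 * Ex f) * f w).
  exact: (bounded_mfunM (bounded_mfun_cst _) bf).
have -> : Var f = Ex (fun w => (f w ^+ 2 - (2 * Ex f) * f w) + Ex f ^+ 2).
  by congr Ex; apply/funext => w; ring.
rewrite ExD; [|exact: bounded_mfunB|exact: bounded_mfun_cst].
by rewrite ExB// ExZ// Ex_cst; ring.
Qed.

(** From [(x - y) ^ 2 <= 2 x ^ 2 + 2 y ^ 2]; the variance of [beta] is thus bounded without the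
    covariance of [Rrec] and [rcur]. *)
Lemma VarB_le f g : bounded_mfun f -> bounded_mfun g ->
  Var (fun w => f w - g w) <= 2 * Var f + 2 * Var g.
Proof.
move=> bf bg; have cf := bounded_mfun_center (Ex f) bf; have cg := bounded_mfun_center (Ex g) bg.
have sc h : bounded_mfun h -> bounded_mfun (fun w => 2 * h w).
  by move=> bh; exact: (bounded_mfunM (bounded_mfun_cst _) bh).
rewrite /Var -!ExZ// -ExD; [|exact: sc..]; apply: le_Ex.
- by apply: bounded_mfun_center; exact: bounded_mfunB.
- by apply: bounded_mfunD; exact: sc.
move=> w; rewrite ExB//; have := sqr_ge0 ((f w - Ex f) + (g w - Ex g)).
by rewrite !expr2; lra.
Qed.

Lemma measurable_dev f c e : bounded_mfun f -> measurable [set w | e <= `|f w - c|].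
Proof.
move=> bf; have [mf _] := bounded_mfunB bf (bounded_mfun_cst c).
have := measurable_fun_ler (measurable_cst e) (measurableT_comp (@normr_measurable R setT) mf).
by move=> /(_ measurableT [set true]); rewrite setTI; exact.
Qed.

Lemma chebyshev_pr f e : bounded_mfun f -> 0 < e ->
  pr [set w | e <= `|f w - Ex f|] <= Var f / e ^+ 2.
Proof.
move=> bf e0; set A := [set _ | _]; have mA : measurable A by exact: measurable_dev.
rewrite ler_pdivlMr ?exprn_gt0// mulrC -Ex_indic// -ExZ; last exact: bounded_mfun_indic.
apply: le_Ex.
- exact: (bounded_mfunM (bounded_mfun_cst _) (bounded_mfun_indic mA)).
- exact: bounded_mfun_center.
move=> w; rewrite indicE; case: (boolP (w \in A)) => [|_]; last by rewrite mulr0 sqr_ge0.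
rewrite inE => h; rewrite mulr1 -[leRHS]real_normK ?num_real//.
by rewrite lerXn2r ?nnegrE// ltW.
Qed.

Lemma Var_sum_indic n (A : nat -> set T) : (forall k, measurable (A k)) ->
  let f := fun w => \sum_(k < n) \1_(A k) w : R in
  [/\ bounded_mfun f, Ex f = \sum_(k < n) pr (A k) &
    Var f = \sum_(k < n) \sum_(j < n) pr (A j `&` A k) - (\sum_(k < n) pr (A k)) ^+ 2].
Proof.
move=> mA f.
have bf : bounded_mfun f by apply: bounded_mfun_sum => k; exact: bounded_mfun_indic.
have Ef : Ex f = \sum_(k < n) pr (A k).
  rewrite /f Ex_sum; last by move=> k; exact: bounded_mfun_indic.
  by apply: eq_bigr => k _; rewrite Ex_indic.
split => //; rewrite VarE// Ef; congr (_ - _).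
have -> : (fun w => f w ^+ 2) = (fun w => \sum_(k < n) \sum_(j < n) \1_(A j `&` A k) w).
  apply/funext => w; rewrite /f expr2 mulr_sumr; apply: eq_bigr => k _.
  rewrite mulr_suml; apply: eq_bigr => j _; rewrite !indicE in_setI.
  by case: (w \in A j); case: (w \in A k); rewrite ?mulr1 ?mulr0 ?mul0r.
have mI j k : measurable (A j `&` A k) by exact: measurableI.
rewrite Ex_sum; last by move=> k; apply: bounded_mfun_sum => j; exact: bounded_mfun_indic.
apply: eq_bigr => k _; rewrite Ex_sum; last by move=> j; exact: bounded_mfun_indic.
by apply: eq_bigr => j _; rewrite Ex_indic.
Qed.

End bounded_expectation.

(** * Almost sure concentration of monotone counts *)

Section fourth_power_blocks.
Context {R : realType}.

Lemma fourth_root_floor (x : R) : 0 <= x ->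
  exists k : nat, k%:R ^+ 4 <= x < k.+1%:R ^+ 4.
Proof.
move=> x0; have ex : exists k : nat, x < k.+1%:R ^+ 4.
  exists (Num.truncn x); apply: lt_le_trans (truncnS_gt x) _.
  by rewrite -natrX ler_nat -{1}[(Num.truncn x).+1]expn1 leq_pexp2l.
have [k xk kmin] := ex_minnP ex; exists k; rewrite xk andbT.
case: k xk kmin => [|k] _ kmin; first by rewrite expr0n.
by rewrite leNgt; apply/negP => /kmin; rewrite ltnn.
Qed.

Lemma block_gap (k : nat) : (0 < k)%N -> k.+1%:R ^+ 4 <= k%:R ^+ 4 + 15 * k%:R ^+ 3 :> R.
Proof.
move=> k0; have : 1 <= k%:R :> R by rewrite ler1n.
rewrite -natr1; set y := k%:R => y1.
have h2 : 1 <= y ^+ 2 by rewrite exprn_ege1.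
have h3 : y ^+ 2 <= y ^+ 3 by apply: ler_weXn2l.
have h1 : y <= y ^+ 2 by rewrite -{1}[y]expr1; apply: ler_weXn2l.
have -> : (y + 1) ^+ 4 = y ^+ 4 + 4 * y ^+ 3 + 6 * y ^+ 2 + 4 * y + 1 by ring.
lra.
Qed.

Lemma sum_inv_sqr_le N : \sum_(0 <= j < N) (j.+1%:R ^+ 2)^-1 <= 2 :> R.
Proof.
case: N => [|N]; first by rewrite big_nil.
(* The extra [1 / N.+1] makes the induction telescope. *)
suff h : \sum_(0 <= j < N.+1) (j.+1%:R ^+ 2)^-1 + (N.+1%:R)^-1 <= 2 :> R.
  by apply: le_trans h; rewrite lerDl.
elim: N => [|N IH]; first by rewrite big_nat1 expr1n invr1.
rewrite big_nat_recr//=; apply: le_trans IH; rewrite -addrA lerD2l.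
have y0 : 0 < N.+1%:R :> R by rewrite ltr0n.
rewrite -[N.+2%:R]natr1; set y := N.+1%:R in y0 *.
have -> : ((y + 1) ^+ 2)^-1 + (y + 1)^-1 = (y + 2) / (y + 1) ^+ 2.
  by field; rewrite lt0r_neq0//; lra.
rewrite ler_pdivrMr ?exprn_gt0//; last lra.
rewrite mulrC ler_pdivlMr// expr2; nra.
Qed.

End fourth_power_blocks.

Section monotone_concentration.
Context {R : realType} {dT : measure_display} {T : measurableType dT}.
Variables (P : probability T R) (Z : nat -> T -> nat).
Local Notation pr := (pr P).
Local Notation Zr n := (fun w => (Z n w)%:R : R).
Local Notation m := (Enat P Z).
Hypothesis bZ : forall n, bounded_mfun (Zr n).
Hypothesis Znd : forall w n k, (n <= k)%N -> (Z n w <= Z k w)%N.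
Variables (C : R) (n1 : nat).
Hypothesis C0 : 0 <= C.
Hypothesis VZ : forall n, (n1 <= n)%N -> Var P (Zr n) <= C * m n.
Hypothesis m_oo : forall M : R, exists n, M <= m n.

Lemma mean_nd n k : (n <= k)%N -> m n <= m k.
Proof. by move=> nk; apply: le_Ex => // w; rewrite ler_nat Znd. Qed.

Definition in_block (j n : nat) : bool :=
  (n1 <= n)%N && (j%:R ^+ 4 <= m n < j.+1%:R ^+ 4).

(** A block is finite because the mean is unbounded. An empty block has no ends and receives an
    arbitrary pair. *)
Lemma block_ends j : exists ab : nat * nat, forall n, in_block j n ->
  [/\ in_block j ab.1, in_block j ab.2 & (ab.1 <= n <= ab.2)%N].
Proof.
have [[n jn]|none] := pselect (exists n, in_block j n); last first.
  by exists (0, 0)%N => n jn; case: none; exists n.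
have ex : exists n, in_block j n by exists n.
have [N hN] := m_oo (j.+1%:R ^+ 4).
have ub k : in_block j k -> (k <= N)%N.
  move=> /andP[_ /andP[_ h]]; rewrite leqNgt; apply/negP => Nk.
  by have := mean_nd (ltnW Nk); rewrite leNgt (lt_le_trans h hN).
have [a ha amin] := ex_minnP ex; have [b hb bmax] := ex_maxnP ex ub.
by exists (a, b) => k hk; split => //; rewrite amin//= bmax.
Qed.

Definition dev (n : nat) (e : R) : set T := [set w | e <= `|Zr n w - m n|].

Lemma dev_measurable n e : measurable (dev n e).
Proof. exact: measurable_dev. Qed.

(** The variance is at most [C * j.+1 ^ 4 <= 16 * C * j ^ 4]; against the squared deviation [j ^ 6]
    this leaves a summable multiple of [1 / j ^ 2]. *)
Lemma pr_dev n j : (0 < j)%N -> in_block j n -> pr (dev n (j%:R ^+ 3)) <= 16 * C / j%:R ^+ 2.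
Proof.
move=> j0 /andP[nn1 /andP[h1 h2]]; have j1 : 0 < j%:R :> R by rewrite ltr0n.
apply: le_trans (chebyshev_pr P (bZ n) _) _; first by rewrite exprn_gt0.
rewrite ler_pdivrMr ?exprn_gt0//; apply: le_trans (VZ nn1) _.
have -> : 16 * C / j%:R ^+ 2 * (j%:R ^+ 3) ^+ 2 = C * (16 * j%:R ^+ 4).
  by field; exact: lt0r_neq0.
apply: ler_wpM2l => //; apply: le_trans (ltW h2) _.
have -> : 16 * j%:R ^+ 4 = (2 * j%:R) ^+ 4 :> R by ring.
apply: lerXn2r; rewrite ?nnegrE ?mulr_ge0// -natrM ler_nat.
by move: j0; clear; lia.
Qed.

(* Within a block only its first and last index matter, by monotonicity. *)
Lemma monotone_concentration :
  {ae P, forall w, exists N, forall n, (N <= n)%N ->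
     `|(Z n w)%:R - m n| ^+ 4 <= 16 ^+ 4 * m n ^+ 3}.
Proof.
have [ab hab] := choice block_ends.
(* The test makes [F j] empty when the block is, where the pair of ends carries no information.
   Blocks are numbered from 1, since for block 0 the allowed deviation would be 0. *)
pose F j : set T := if in_block j.+1 (ab j.+1).1 && in_block j.+1 (ab j.+1).2 then
  dev (ab j.+1).1 (j.+1%:R ^+ 3) `|` dev (ab j.+1).2 (j.+1%:R ^+ 3) else set0.
have mF j : measurable (F j).
  by rewrite /F; case: ifP => _ //; apply: measurableU; exact: dev_measurable.
have prF j : pr (F j) <= 32 * C / j.+1%:R ^+ 2.
  rewrite /F; case: ifP => [/andP[h1 h2]|_]; last first.
    by rewrite pr0 divr_ge0 ?mulr_ge0 ?exprn_ge0.
  apply: le_trans (prU_le P (dev_measurable _ _) (dev_measurable _ _)) _.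
  have -> : 32 * C / j.+1%:R ^+ 2 = 16 * C / j.+1%:R ^+ 2 + 16 * C / j.+1%:R ^+ 2.
    by rewrite -mulrDl; congr (_ / _); ring.
  by apply: lerD; exact: pr_dev.
have sumF : (\sum_(j <oo) P (F j) < +oo)%E.
  apply: (@le_lt_trans _ _ ((64 * C)%:E)); last exact: ltry.
  apply: lime_le; first exact: is_cvg_nneseries.
  apply: nearW => N; under eq_bigr => j _ do rewrite (prE P (mF j)).
  rewrite sumEFin lee_fin; apply: (@le_trans _ _ (\sum_(0 <= j < N) 32 * C * (j.+1%:R ^+ 2)^-1)).
    by apply: ler_sum => j _; exact: prF.
  have -> : 64 * C = 32 * C * 2 by ring.
  by rewrite -mulr_sumr ler_wpM2l ?mulr_ge0 ?sum_inv_sqr_le.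
exists (lim_sup_set F); split.
- by apply: bigcap_measurable => // k _; exact: bigcup_measurable.
- exact: lim_sup_set_cvg0.
move=> w; apply: contra_notP => nlim.
have [N0 hN0] : exists N0, forall j, (N0 <= j)%N -> ~ F j w.
  apply: contrapT => hn; apply: nlim => k _; apply: contrapT => hk; apply: hn.
  by exists k => j kj Fj; apply: hk; exists j.
have [N1 hN1] := m_oo (N0.+1%:R ^+ 4).
exists (maxn n1 N1) => n; rewrite geq_max => /andP[nn1 nN1].
have mn : N0.+1%:R ^+ 4 <= m n := le_trans hN1 (mean_nd nN1).
have m0 : 0 <= m n by apply: le_trans mn; rewrite exprn_ge0.
have [k /andP[k1 k2]] := fourth_root_floor m0.
have N0k : (N0.+1 <= k)%N.
  rewrite leqNgt; apply/negP => kN; have := le_lt_trans mn k2.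
  by rewrite -!natrX ltr_nat ltn_exp2r// ltnNge kN.
have kn : in_block k n by rewrite /in_block nn1 k1 k2.
have [ha hb /andP[an nb]] := hab k n kn.
have k0 : (0 < k)%N by exact: leq_trans N0k.
have := hN0 k.-1; rewrite -ltnS prednK// => /(_ N0k).
rewrite /F prednK// ha hb /= => /not_orP[].
rewrite /dev /= => /negP; rewrite -ltNge => da /negP; rewrite -ltNge => db.
have kgap := @block_gap R k k0.
move: ha hb => /andP[_ /andP[ha1 ha2]] /andP[_ /andP[hb1 hb2]].
have za : (Z (ab k).1 w)%:R <= (Z n w)%:R :> R by rewrite ler_nat Znd.
have zb : (Z n w)%:R <= (Z (ab k).2 w)%:R :> R by rewrite ler_nat Znd.
(* 16 = 1 + 15: the deviation at an end of the block plus the variation of the mean within it, by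
   [block_gap]. *)
have main : `|(Z n w)%:R - m n| <= 16 * k%:R ^+ 3.
  move: da db; rewrite !ltr_norml ler_norml => /andP[da1 da2] /andP[db1 db2].
  by apply/andP; split; lra.
have k3 : 0 <= k%:R ^+ 3 :> R by rewrite exprn_ge0.
apply: (@le_trans _ _ ((16 * k%:R ^+ 3) ^+ 4)).
  by apply: lerXn2r; rewrite ?nnegrE// mulr_ge0.
have -> : (16 * k%:R ^+ 3) ^+ 4 = 16 ^+ 4 * (k%:R ^+ 4) ^+ 3 :> R.
  by rewrite exprMn -!exprM.
by rewrite ler_wpM2l ?exprn_ge0//; apply: lerXn2r => //; rewrite nnegrE// exprn_ge0.
Qed.

End monotone_concentration.

(** * Deviations on the logarithmic scale *)

Section logarithmic_deviation.
Context {R : realType} {dT : measure_display} {T : measurableType dT}.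
Variables (P : probability T R) (d : nat).
Implicit Types (Z : nat -> T -> nat) (D : R).

Lemma ln_nat_oo (M : R) : exists N, forall n, (N <= n)%N -> M < ln n%:R.
Proof.
exists (Num.truncn (expR M)).+1 => n Nn.
have h : expR M < n%:R.
  by apply: lt_le_trans (truncnS_gt _) _; rewrite ler_nat.
by rewrite -(expRK M) ltr_ln ?posrE ?expR_gt0// (lt_trans _ h)// expR_gt0.
Qed.

Lemma powR_ln_nat_oo (M s : R) : 0 < s ->
  exists N, forall n, (N <= n)%N -> M < ln n%:R `^ s.
Proof.
move=> s0; pose y : R := Num.max M 1.
have y1 : 1 <= y by rewrite /y le_max lexx orbT.
have [N hN] := ln_nat_oo (y `^ s^-1); exists N => n /hN h.
have y0 : 0 <= y by lra.
apply: le_lt_trans (_ : y < _); first by rewrite /y le_max lexx.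
have -> : y = (y `^ s^-1) `^ s by rewrite -powRrM mulVf ?powRr1// gt_eqF.
apply: gt0_ltr_powR => //; rewrite nnegrE ?powR_ge0//.
by apply: le_trans (ltW h); rewrite powR_ge0.
Qed.

(** Fourth powers make the exponent [3 d / 4] a natural number. *)
Definition log_deviation Z D : Prop :=
  {ae P, forall w, exists N, forall n, (N <= n)%N ->
     `|(Z n w)%:R - Enat P Z n| ^+ 4 <= D * ln n%:R ^+ (3 * d)}.

Lemma dev_io_measurable Z a : (forall n, bounded_mfun (fun w => (Z n w)%:R : R)) ->
  measurable (dev_io P Z a).
Proof.
move=> bZ; have -> : dev_io P Z a = \bigcap_N \bigcup_(n >= N)
    [set w | powR (ln n%:R) a <= `|(Z n w)%:R - Enat P Z n|].
  apply/seteqP; split => w h N; first by move=> _; have [n Nn hn] := h N; exists n.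
  by have [n Nn hn] := h N I; exists n.
apply: bigcap_measurable => // N _; apply: bigcup_measurable => n _.
exact: measurable_dev.
Qed.

(** After taking fourth powers, the factor [ln n ^ (4 eps)] eventually exceeds the constant [D]. *)
Lemma dev_io_null Z D eps : (forall n, bounded_mfun (fun w => (Z n w)%:R : R)) ->
  log_deviation Z D -> 0 < eps -> P (dev_io P Z (3 * d%:R / 4 + eps)) = 0%E.
Proof.
move=> bZ lZ e0; apply: measure_negligible; first exact: dev_io_measurable.
have [A [mA A0 hA]] := lZ; exists A; split => // w io; apply: hA => /= -[N hN].
have e4 : 0 < 4 * eps by rewrite mulr_gt0.
have [N1 hN1] := powR_ln_nat_oo D e4; have [N2 hN2] := ln_nat_oo 0.
have [n] := io (maxn N (maxn N1 N2)); rewrite !geq_max => /and3P[nN nN1 nN2].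
apply/negP; rewrite -ltNge; set x := `|_|.
have l0 := hN2 n nN2; set l := ln n%:R in l0 *.
have h : x ^+ 4 < (l `^ (3 * d%:R / 4 + eps)) ^+ 4.
  apply: le_lt_trans (hN n nN) _; rewrite -/l -[ltRHS]powR_mulrn ?powR_ge0// -powRrM.
  have -> : (3 * d%:R / 4 + eps) * 4%:R = 4 * eps + (3 * d)%:R by rewrite natrM; field.
  rewrite powRD ?powR_mulrn; [|exact: ltW|by rewrite (gt_eqF l0) implybT].
  by rewrite ltr_pM2r ?exprn_gt0// hN1.
by rewrite -(@ltr_pXn2r R 4) ?nnegrE ?normr_ge0 ?powR_ge0.
Qed.

(** The fourth power of the relative error is at most a constant times [ln n ^ (3 d - 4 k)], a
    negative power. *)
Lemma log_deviation_ratio Z D c k : 0 < c -> (3 * d < 4 * k)%N ->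
  (exists n0, forall n, (n0 <= n)%N -> c * ln n%:R ^+ k <= Enat P Z n) ->
  log_deviation Z D -> ratio_to_one P Z.
Proof.
move=> c0 dk [n0 hm] lZ.
have [A [mA A0 hA]] := lZ; exists A; split => // w nc; apply: hA => /= -[N hN].
apply: nc; apply/cvgrPdist_le => e e0.
have ec0 : 0 < e ^+ 4 * c ^+ 4 by rewrite mulr_gt0 ?exprn_gt0.
have [N1 hN1] := ln_nat_oo (Num.max 1 (D / (e ^+ 4 * c ^+ 4))).
exists (maxn n0 (maxn N N1)) => // n /=; rewrite !geq_max => /and3P[nn0 nN nN1].
have := hN1 n nN1; rewrite gt_max => /andP[l1 lD].
have hmn := hm n nn0; have hd := hN n nN; set l := ln n%:R in l1 lD hmn hd.
have l0 : 0 < l by lra.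
have m0 : 0 < Enat P Z n by apply: lt_le_trans hmn; rewrite mulr_gt0 ?exprn_gt0.
have -> : 1 - (Z n w)%:R / Enat P Z n = - (((Z n w)%:R - Enat P Z n) / Enat P Z n).
  by field; exact: lt0r_neq0.
rewrite normrN normrM normfV (gtr0_norm m0) ler_pdivrMr//.
rewrite -(@ler_pXn2r R 4) ?nnegrE ?normr_ge0 ?mulr_ge0 ?(ltW e0) ?(ltW m0)//.
apply: le_trans hd _; rewrite exprMn.
apply: (@le_trans _ _ (e ^+ 4 * (c * l ^+ k) ^+ 4)); last first.
  by rewrite ler_wpM2l ?exprn_ge0 ?lerXn2r ?nnegrE ?mulr_ge0 ?exprn_ge0// ltW.
rewrite exprMn -exprM mulrA.
apply: (@le_trans _ _ (e ^+ 4 * c ^+ 4 * (l * l ^+ (3 * d)))).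
  rewrite mulrA ler_wpM2r ?exprn_ge0 ?ltW//; move: lD; rewrite ltr_pdivrMr// mulrC => /ltW //.
rewrite ler_wpM2l ?(ltW ec0)// -exprS ler_weXn2l ?(ltW l1)//.
by rewrite [(k * 4)%N]mulnC.
Qed.

(** Serves [rcur], which is not monotone in [n]; the 8 comes from
    [(x - y) ^ 4 <= 8 (x ^ 4 + y ^ 4)]. *)
Lemma log_deviationB Z Z1 Z2 D1 D2 :
  (forall n, bounded_mfun (fun w => (Z1 n w)%:R : R)) ->
  (forall n, bounded_mfun (fun w => (Z2 n w)%:R : R)) ->
  (forall n w, (Z n w)%:R = (Z1 n w)%:R - (Z2 n w)%:R :> R) ->
  log_deviation Z1 D1 -> log_deviation Z2 D2 -> log_deviation Z (8 * (D1 + D2)).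
Proof.
move=> b1 b2 ZE [A1 [mA1 A10 hA1]] [A2 [mA2 A20 hA2]].
exists (A1 `|` A2); split; first exact: measurableU.
  by apply: measure_negligible; [exact: measurableU|apply: negligibleU; apply/negligibleP].
move=> w nw; apply: contrapT => /not_orP[nA1 nA2].
have [N1 hN1] : exists N, forall n, (N <= n)%N ->
    `|(Z1 n w)%:R - Enat P Z1 n| ^+ 4 <= D1 * ln n%:R ^+ (3 * d).
  by apply: contrapT => h; apply: nA1; exact: hA1.
have [N2 hN2] : exists N, forall n, (N <= n)%N ->
    `|(Z2 n w)%:R - Enat P Z2 n| ^+ 4 <= D2 * ln n%:R ^+ (3 * d).
  by apply: contrapT => h; apply: nA2; exact: hA2.
apply: nw; exists (maxn N1 N2) => n; rewrite geq_max => /andP[/hN1 h1 /hN2 h2].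
have mE : Enat P Z n = Enat P Z1 n - Enat P Z2 n.
  rewrite -[Enat P Z n]/(Ex P (fun w => (Z n w)%:R)) -ExB//.
  by congr Ex; apply/funext => w'; exact: ZE.
rewrite mE ZE; set x := (Z1 n w)%:R - _ in h1; set y := (Z2 n w)%:R - _ in h2.
have -> : (Z1 n w)%:R - (Z2 n w)%:R - (Enat P Z1 n - Enat P Z2 n) = x - y.
  by rewrite /x /y; ring.
have nx (z : R) : `|z| ^+ 4 = z ^+ 4 by rewrite -normrX ger0_norm// -[4%N]/(2 * 2)%N exprM sqr_ge0.
rewrite !nx in h1 h2 *.
apply: (@le_trans _ _ (8 * (x ^+ 4 + y ^+ 4))); last first.
  by rewrite -mulrA ler_wpM2l// mulrDl lerD.
have s1 : (x - y) ^+ 2 <= 2 * (x ^+ 2 + y ^+ 2).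
  by have := sqr_ge0 (x + y); rewrite !expr2; lra.
apply: (@le_trans _ _ ((2 * (x ^+ 2 + y ^+ 2)) ^+ 2)).
  by rewrite -[4%N]/(2 * 2)%N exprM lerXn2r ?nnegrE ?sqr_ge0// mulr_ge0// addr_ge0 ?sqr_ge0.
have := sqr_ge0 (x ^+ 2 - y ^+ 2).
have -> : x ^+ 4 = x ^+ 2 * x ^+ 2 by rewrite -exprD.
have -> : y ^+ 4 = y ^+ 2 * y ^+ 2 by rewrite -exprD.
by rewrite [(_ - _) ^+ 2]expr2 [(2 * _) ^+ 2]expr2; move: (x ^+ 2) (y ^+ 2) => u v; lra.
Qed.

End logarithmic_deviation.

(** * Records *)

Lemma sum_sym_split {R : realFieldType} n (f : nat -> nat -> R) :
  (forall j k, f j k = f k j) ->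
  \sum_(k < n) \sum_(j < n) f j k = \sum_(k < n) f k k + 2 * \sum_(k < n) \sum_(j < k) f j k.
Proof.
move=> fC; elim: n => [|n IH]; first by rewrite !big_ord0 mulr0 addr0.
rewrite big_ord_recr /= (eq_bigr (fun k : 'I_n => \sum_(j < n) f j k + f n k)); last first.
  by move=> k _; rewrite big_ord_recr.
rewrite big_split /= IH [\sum_(i < n.+1) f i n]big_ord_recr /= !big_ord_recr /= mulrDr.
have -> : \sum_(k < n) f n k = \sum_(k < n) f k n by apply: eq_bigr => k _; rewrite fC.
by ring.
Qed.

Section records.
Context {R : realType} {dT : measure_display} {T : measurableType dT}.
Variables (P : probability T R) (d' : nat) (X : nat -> 'I_d'.+1 -> T -> R).
Local Notation d := d'.+1.
Implicit Types (w : T) (n k : nat).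

(** With no coordinates [prec] would hold vacuously, hence the successor dimension in this
    section. *)
Lemma prec_irrefl (x : 'I_d -> R) : prec x x = false.
Proof. by apply/negP => /forallP /(_ ord0); rewrite ltxx. Qed.

Lemma is_recordE w n k : (k < n)%N ->
  is_record X w k = (w \in undominated X n (earlier k) k).
Proof.
move=> kn; apply/forallP/idP => [h|].
  by rewrite inE => i iN _ ik; exact: (h (Ordinal ik)).
by rewrite inE => h i; apply: h; [exact: ltn_trans kn|rewrite ltn_eqF|exact: ltn_ord].
Qed.

Lemma is_current_recordE w n k : (k < n)%N ->
  is_current_record X n w k = (w \in undominated X n xpredT k).
Proof.
move=> kn; apply/forallP/idP => [h|].
  by rewrite inE => i iN _ _; exact: (h (Ordinal iN)).
(* [is_current_record] compares [k] with itself too, unlike [undominated]. *)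
rewrite inE => h i; have [->|ik] := eqVneq (i : nat) k; first by rewrite prec_irrefl.
exact: h.
Qed.

Lemma count_indic n (a : pred nat) (A : nat -> set T) w :
  (forall k, (k < n)%N -> a k = (w \in A k)) ->
  (count a (iota 0 n))%:R = \sum_(k < n) \1_(A k) w :> R.
Proof.
move=> h; rewrite -sum1_count big_mkcond /=.
have -> : iota 0 n = index_iota 0 n by rewrite /index_iota subn0.
rewrite big_mkord natr_sum; by apply: eq_bigr => k _; rewrite indicE -h.
Qed.

Lemma current_is_record w n k : (k < n)%N ->
  is_current_record X n w k -> is_record X w k.
Proof.
move=> kn /forallP h; apply/forallP => i; exact: (h (widen_ord (ltnW kn) i)).
Qed.

Lemma Rrec_nd w n k : (n <= k)%N -> (Rrec X n w <= Rrec X k w)%N.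
Proof.
by move=> nk; rewrite /Rrec -(subnKC nk) iotaD count_cat leq_addr.
Qed.

Lemma rcur_le_Rrec n w : (rcur X n w <= Rrec X n w)%N.
Proof.
rewrite /rcur /Rrec -!size_filter; apply: uniq_leq_size; first by rewrite filter_uniq ?iota_uniq.
move=> k; rewrite !mem_filter => /andP[ck kn]; rewrite kn andbT.
by apply: current_is_record ck; rewrite mem_iota in kn.
Qed.

(** A difference of two counts hides monotonicity in [n]; as a count of records already broken,
    [beta] shows it. *)
Lemma betaE n w : beta X n w =
  count (fun k => is_record X w k && ~~ is_current_record X n w k) (iota 0 n).
Proof.
rewrite /beta /Rrec /rcur; set a := is_record X w; set c := is_current_record X n w.
have -> : count a (iota 0 n) = (count c (iota 0 n) +
    count (fun k => a k && ~~ c k) (iota 0 n))%N.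
  have -> : count c (iota 0 n) = count (fun k => a k && c k) (iota 0 n).
    apply: eq_in_count => k; rewrite mem_iota /= add0n => kn.
    by apply/idP/andP => [ck|[]//]; split => //; exact: current_is_record ck.
  elim: (iota 0 n) => //= k s ->; case: (a k); case: (c k) => /=; lia.
by rewrite addKn.
Qed.

(** A broken record stays broken. *)
Lemma beta_nd w n k : (n <= k)%N -> (beta X n w <= beta X k w)%N.
Proof.
move=> nk; rewrite !betaE -(subnKC nk) iotaD count_cat.
apply: leq_trans (leq_addr _ _); apply: sub_count => i /= /andP[-> /=].
apply: contra => /forallP h; apply/forallP => j.
by apply: (h (widen_ord _ j)); rewrite subnKC.
Qed.

Lemma natr_beta n w : (beta X n w)%:R = (Rrec X n w)%:R - (rcur X n w)%:R :> R.
Proof. by rewrite natrB ?rcur_le_Rrec. Qed.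


Hypothesis mX : forall k j, measurable_fun setT (X k j).
Hypothesis eX : forall k j, exp1_distributed P (X k j).
Hypothesis iX : mutually_independent P (fun kj : nat * 'I_d => X kj.1 kj.2).
Local Notation p := (undominated_prob P X).

Lemma Rrec_moments n : let f := fun w => (Rrec X n w)%:R : R in
  [/\ bounded_mfun f, Ex P f = \sum_(k < n) p k &
   Var P f <= \sum_(k < n) p k + 2 * \sum_(k < n) \sum_(j < k)
    (pr P (undominated X n (earlier j) j `&` undominated X n (earlier k) k) - p j * p k)].
Proof.
move=> f; pose A k := undominated X n (earlier k) k.
have mA k : measurable (A k) by exact: undominated_measurable.
have -> : f = fun w => \sum_(k < n) \1_(A k) w.
  by apply/funext => w; apply: count_indic => k kn; exact: is_recordE.
have [bf Ef Vf] := Var_sum_indic P n mA; split => //.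
  by rewrite Ef; apply: eq_bigr => k _; exact: pr_record.
rewrite Vf (sum_sym_split n (f := fun j k => pr P (A j `&` A k))); last first.
  by move=> j k; rewrite setIC.
have -> : \sum_(k < n) pr P (A k) = \sum_(k < n) p k.
  by apply: eq_bigr => k _; exact: pr_record.
have -> : \sum_(k < n) pr P (A k `&` A k) = \sum_(k < n) p k.
  by apply: eq_bigr => k _; rewrite setIid; exact: pr_record.
have -> : (\sum_(k < n) p k) ^+ 2 = \sum_(k < n) \sum_(j < n) p j * p k.
  by rewrite expr2 mulr_sumr; apply: eq_bigr => k _; rewrite mulr_suml.
rewrite (sum_sym_split n (f := fun j k => p j * p k)); last by move=> j k; rewrite mulrC.
have -> : \sum_(k < n) \sum_(j < k) (pr P (A j `&` A k) - p j * p k) =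
    \sum_(k < n) \sum_(j < k) pr P (A j `&` A k) - \sum_(k < n) \sum_(j < k) p j * p k.
  by rewrite -sumrB; apply: eq_bigr => k _; rewrite sumrB.
(* The diagonal of the squared mean enters the variance negatively and is dropped. *)
have : 0 <= \sum_(k < n) p k * p k.
  by apply: sumr_ge0 => k _; rewrite -expr2 sqr_ge0.
lra.
Qed.

Lemma rcur_moments n : let f := fun w => (rcur X n w)%:R : R in
  [/\ bounded_mfun f, Ex P f = n%:R * p n.-1 &
   Var P f = n%:R * p n.-1 + (\sum_(k < n) \sum_(j < n | j != k)
    pr P (undominated X n xpredT j `&` undominated X n xpredT k) - (n%:R * p n.-1) ^+ 2)].
Proof.
move=> f; pose A k := undominated X n xpredT k.
have mA k : measurable (A k) by exact: undominated_measurable.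
have -> : f = fun w => \sum_(k < n) \1_(A k) w.
  by apply/funext => w; apply: count_indic => k kn; exact: is_current_recordE.
have [bf Ef Vf] := Var_sum_indic P n mA.
have sumA : \sum_(k < n) pr P (A k) = n%:R * p n.-1.
  rewrite mulr_natl -[n in _ *+ n]card_ord -sumr_const.
  by apply: eq_bigr => k _; exact: pr_current.
split => //; first by rewrite Ef.
rewrite Vf sumA addrA; congr (_ - _); rewrite -sumA -big_split /=.
by apply: eq_bigr => k _; rewrite (bigD1 k)//= setIid.
Qed.

Lemma beta_moments n : let f := fun w => (beta X n w)%:R : R in
  [/\ bounded_mfun f, Ex P f = \sum_(k < n) p k - n%:R * p n.-1 &
   Var P f <= 2 * Var P (fun w => (Rrec X n w)%:R) + 2 * Var P (fun w => (rcur X n w)%:R)].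
Proof.
move=> f; have [b1 E1 _] := Rrec_moments n; have [b2 E2 _] := rcur_moments n.
have -> : f = fun w => (Rrec X n w)%:R - (rcur X n w)%:R.
  by apply/funext => w; exact: natr_beta.
by split; [exact: bounded_mfunB|rewrite ExB// E1 E2|exact: VarB_le].
Qed.

Lemma trunc_log2_ln n : (0 < n)%N ->
  (trunc_log 2 n)%:R * ln 2 <= (ln n%:R : R) <= 2 * (trunc_log 2 n).+1%:R.
Proof.
move=> n0; set l := trunc_log 2 n.
have n0' : 0 < n%:R :> R by rewrite ltr0n.
have lnX k : ln ((2 ^ k)%:R : R) = k%:R * ln 2 by rewrite natrX lnXn// mulr_natl.
apply/andP; split.
  by rewrite -lnX ler_ln ?posrE// ?ltr0n ?expn_gt0// ler_nat trunc_logP.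
apply: (@le_trans _ _ (l.+1%:R * ln 2)).
  by rewrite -lnX ler_ln ?posrE// ?ltr0n ?expn_gt0// ler_nat ltnW// trunc_log_ltn.
by rewrite mulrC ler_wpM2r// ltW// ln_sublinear.
Qed.

Lemma record_growth : exists (C c : R) (n0 : nat), [/\ 0 < C, 0 < c & forall n, (n0 <= n)%N ->
  let l := (trunc_log 2 n)%:R in
  [/\ Enat P (Rrec X) n <= C * l ^+ d, c * l ^+ d <= Enat P (beta X) n,
      Enat P (beta X) n <= Enat P (Rrec X) n,
      Var P (fun w => (Rrec X n w)%:R) <= C * l ^+ d &
      Var P (fun w => (beta X n w)%:R) <= C * l ^+ d]].
Proof.
have [c [n1 [c0 hc]]] := broken_order mX eX iX.
(* 4650 is twice 17 + 2308, where 17 = 3 + 2 * 7 and 2308 = 3 + 2305 bound the variances of [Rrec]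
   and [rcur] in units of [(128 * l) ^ d]. *)
have [C [C0 CE]] : exists C : R, 0 < C /\ forall x, 4650 * (128 * x) ^+ d = C * x ^+ d.
  exists (4650 * 128 ^+ d); split; last by move=> x; rewrite exprMn mulrA.
  exact: mulr_gt0 (ltr0Sn _ _) (exprn_gt0 _ (ltr0Sn _ _)).
exists C, c, (maxn n1 64); split => //.
move=> n; rewrite geq_max => /andP[nn1 n64] l.
have [h1 h2 h3] := upper_orders mX eX iX n64; rewrite -/l in h1 h2 h3.
have [_ ER VR] := Rrec_moments n; have [_ Er Vr] := rcur_moments n.
have [_ Eb Vb] := beta_moments n.
have hb := hc n nn1; rewrite -/l in hb.
have -> : Enat P (Rrec X) n = \sum_(k < n) p k := ER.
have -> : Enat P (beta X) n = \sum_(k < n) p k - n%:R * p n.-1 := Eb.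
have x0 : 0 <= (128 * l) ^+ d by exact: exprn_ge0 (mulr_ge0 (ler0n _ _) (ler0n _ _)).
have np0 : 0 <= n%:R * p n.-1.
  by rewrite mulr_ge0//; case/andP: (undominated_prob_itv P mX n.-1).
have b0 : 0 <= c * l ^+ d by rewrite mulr_ge0 ?exprn_ge0 ?ler0n// ltW.
rewrite -CE.
set x := (128 * l) ^+ d in h1 h2 h3 x0 *.
have a1 : Var P (fun w => (Rrec X n w)%:R) <= 17 * x by apply: le_trans VR _; lra.
have a2 : Var P (fun w => (rcur X n w)%:R) <= 2308 * x.
  by rewrite Vr; apply: le_trans (lerD _ h3) (_ : 3 * x + _ <= _); lra.
have a3 : Var P (fun w => (beta X n w)%:R) <= 4650 * x by apply: le_trans Vb _; lra.
by split; [lra|exact: hb|rewrite gerBl|lra|exact: a3].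
Qed.

End records.

(** * From orders of growth to almost sure deviations *)

Section log_growth.
Context {R : realType} {dT : measure_display} {T : measurableType dT}.
Variables (P : probability T R) (d : nat) (Z : nat -> T -> nat) (C c : R) (n0 : nat).
Hypothesis d0 : (0 < d)%N.
Hypotheses (C0 : 0 < C) (c0 : 0 < c).
Hypothesis bZ : forall n, bounded_mfun (fun w => (Z n w)%:R : R).
Hypothesis Znd : forall w n k, (n <= k)%N -> (Z n w <= Z k w)%N.
Hypothesis Zgrowth : forall n, (n0 <= n)%N ->
  [/\ c * (trunc_log 2 n)%:R ^+ d <= Enat P Z n,
      Enat P Z n <= C * (trunc_log 2 n)%:R ^+ d &
      Var P (fun w => (Z n w)%:R) <= C * (trunc_log 2 n)%:R ^+ d].

Let m_oo (M : R) : exists n, M <= Enat P Z n.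
Proof.
pose k := (Num.truncn (M / c)).+1; pose n := maxn n0 (2 ^ k).
exists n; have [h _ _] := Zgrowth (leq_maxl n0 (2 ^ k)); apply: le_trans h.
have kl : (k <= trunc_log 2 n)%N by apply: trunc_log_max => //; exact: leq_maxr.
rewrite mulrC -ler_pdivrMr//; apply: le_trans (ltW (truncnS_gt _)) _.
rewrite -natrX ler_nat (leq_trans kl)// -{1}[trunc_log 2 n]expn1 leq_pexp2l//.
exact: leq_trans kl.
Qed.

Lemma growth_log_deviation : exists D, log_deviation P d Z D.
Proof.
(* Variance and mean have the same order in the logarithm, so the variance is at most a multiple of
   the mean, as the block argument requires. *)
have VZ n : (n0 <= n)%N -> Var P (fun w => (Z n w)%:R) <= C / c * Enat P Z n.
  move=> nn0; have [h1 _ h3] := Zgrowth nn0; apply: le_trans h3 _.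
  rewrite -mulrA ler_pM2l// mulrC ler_pdivlMr// mulrC//.
have [A [mA A0 hA]] := monotone_concentration bZ Znd (ltW (divr_gt0 C0 c0)) VZ m_oo.
have l20 : 0 < ln 2 :> R by rewrite ln_gt0// ltr1n.
exists (16 ^+ 4 * (C / ln 2 ^+ d) ^+ 3), A; split => // w nw; apply: hA => /= -[N hN].
apply: nw; exists (maxn 1 (maxn n0 N)) => n; rewrite !geq_max => /and3P[n1 nn0 nN].
apply: le_trans (hN n nN) _; rewrite -mulrA.
apply: (ler_wpM2l (exprn_ge0 _ (ler0n _ _))).
have [h1 h2 _] := Zgrowth nn0; have /andP[hl _] := @trunc_log2_ln R n n1.
have m0 : 0 <= Enat P Z n by apply: le_trans h1; rewrite mulr_ge0 ?exprn_ge0// ltW.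
have hl0 : 0 <= (trunc_log 2 n)%:R * ln 2 :> R by rewrite mulr_ge0 ?(ltW l20).
have hm : Enat P Z n <= C / ln 2 ^+ d * ln n%:R ^+ d.
  apply: le_trans h2 _; rewrite mulrAC -mulrA ler_pM2l// ler_pdivlMr ?exprn_gt0//.
  by rewrite -exprMn; apply: lerXn2r; rewrite ?nnegrE// (le_trans hl0).
by rewrite mulnC exprM -exprMn; apply: lerXn2r; rewrite ?nnegrE// (le_trans m0).
Qed.

End log_growth.

(** The 4 comes from [ln n <= 2 (l + 1) <= 4 l], where [l] is the truncated logarithm and
    [l >= 1]. *)
Lemma ln_pow_le_of_trunc_log {R : realType} (m : nat -> R) (c : R) (k n0 : nat) : 0 < c ->
  (forall n, (n0 <= n)%N -> c * (trunc_log 2 n)%:R ^+ k <= m n) ->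
  exists n1, forall n, (n1 <= n)%N -> c / 4 ^+ k * ln n%:R ^+ k <= m n.
Proof.
move=> c0 hm; exists (maxn 2 n0) => n; rewrite geq_max => /andP[n2 nn0].
apply: le_trans (hm n nn0); rewrite -mulrA ler_pM2l// mulrC ler_pdivrMr ?exprn_gt0//.
have l1 : (1 <= trunc_log 2 n)%N by apply: trunc_log_max.
have n1 : (0 < n)%N by exact: leq_trans n2.
have /andP[_ hl] := @trunc_log2_ln R n n1.
rewrite -exprMn; apply: lerXn2r; rewrite ?nnegrE ?mulr_ge0//.
  by rewrite ln_ge0// ler1n.
by apply: le_trans hl _; rewrite -!natrM ler_nat; move: l1; clear; lia.
Qed.

(** * Strong laws for records, broken records and current records *)

Theorem theorem4p2 (R : realType) (dT : measure_display) (T : measurableType dT)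
    (P : probability T R) (d : nat) (X : nat -> 'I_d -> T -> R) (eps : R) :
  (1 <= d)%N -> 0 < eps ->
  (forall k j, measurable_fun setT (X k j)) ->
  (forall k j, exp1_distributed P (X k j)) ->
  mutually_independent P (fun kj : nat * 'I_d => X kj.1 kj.2) ->
  let a := (3 * d%:R / 4 + eps) in
  (* (a) *)
  (P (dev_io P (Rrec X) a) = 0%E /\ ratio_to_one P (Rrec X)) /\
  (* (b) *)
  (P (dev_io P (beta X) a) = 0%E /\ ratio_to_one P (beta X)) /\
  (* (c) *)
  (P (dev_io P (rcur X) a) = 0%E /\ ((5 <= d)%N -> ratio_to_one P (rcur X))).
Proof.
case: d X => [//|d'] X _ e0 mX eX iX a; set d := d'.+1 in X mX eX iX a *.
have [C [c [n0 [C0 c0 H]]]] := record_growth mX eX iX.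
have bR n : bounded_mfun (fun w => (Rrec X n w)%:R : R) by have [] := Rrec_moments mX eX iX n.
have bb n : bounded_mfun (fun w => (beta X n w)%:R : R) by have [] := beta_moments mX eX iX n.
have br n : bounded_mfun (fun w => (rcur X n w)%:R : R) by have [] := rcur_moments mX eX iX n.
have gR n : (n0 <= n)%N -> c * (trunc_log 2 n)%:R ^+ d <= Enat P (Rrec X) n.
  by move=> /H[_ h1 h2 _ _]; exact: le_trans h2.
have gb n : (n0 <= n)%N -> c * (trunc_log 2 n)%:R ^+ d <= Enat P (beta X) n.
  by move=> /H[].
have d0 : (0 < d)%N by [].
have [D1 lR] : exists D, log_deviation P d (Rrec X) D.
  apply: (growth_log_deviation d0 C0 c0 bR (@Rrec_nd _ _ _ _ X) (n0 := n0)) => n nn0.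
  by have [? ? ? ? ?] := H n nn0; split => //; exact: gR.
have [D2 lb] : exists D, log_deviation P d (beta X) D.
  apply: (growth_log_deviation d0 C0 c0 bb (@beta_nd _ _ _ _ X) (n0 := n0)) => n nn0.
  by have [h1 h2 h3 h4 h5] := H n nn0; split => //; exact: le_trans h1.
have lr : log_deviation P d (rcur X) (8 * (D1 + D2)).
  by apply: (log_deviationB bR bb _ lR lb) => n w; rewrite natr_beta subKr.
have c4 k : 0 < c / 4 ^+ k by rewrite divr_gt0 ?exprn_gt0.
have d34 : (3 * d < 4 * d)%N by rewrite ltn_mul2r d0.
split; [|split]; split.
- exact: dev_io_null lR e0.
- exact: log_deviation_ratio (c4 d) d34 (ln_pow_le_of_trunc_log c0 gR) lR.
- exact: dev_io_null lb e0.
- exact: log_deviation_ratio (c4 d) d34 (ln_pow_le_of_trunc_log c0 gb) lb.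
- exact: dev_io_null lr e0.
move=> d5; pose c' : R := (8 * (2 * d%:R) ^+ d')^-1.
have c'0 : 0 < c' by rewrite invr_gt0 mulr_gt0// exprn_gt0// mulr_gt0 ?ltr0n.
have gr n : (1 <= n)%N -> c' * (trunc_log 2 n)%:R ^+ d' <= Enat P (rcur X) n.
  move=> n1; have [_ Er _] := rcur_moments mX eX iX n.
  by rewrite [Enat _ _ _]Er mulrC; exact: current_order.
(* [3 d < 4 (d - 1)] holds exactly for [d >= 5]. *)
have dk : (3 * d < 4 * d')%N by move: d5; rewrite /d; clear; lia.
have c'4 : 0 < c' / 4 ^+ d' by rewrite divr_gt0 ?exprn_gt0.
exact: log_deviation_ratio c'4 dk (ln_pow_le_of_trunc_log c'0 gr) lr.
Qed.
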